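(* Let $a<b$, $0<\alpha<1$, $r>0$, and let $u$ be the solution of the steady-state nonlocal problem $$-\int_a^b\frac{u(y)-u(x)}{|x-y|^\alpha}\,dy=f(x),\quad x\in(a,b),\qquad u(x)=0,\quad x\in\mathbb{R}\setminus(a,b),$$ and suppose that $u\in C^2([a,b])$ (so in particular $u(a)=u(b)=0$). For each integer $N\ge 2$ let $U=(u_1,\dots,u_{2N-1})^T$ be the solution of the piecewise linear collocation scheme $AU=F$ on the graded mesh $x_0<x_1<\dots<x_{2N}$ with grading exponent $r$ (see context). Then there is a constant $C>0$, independent of $N$, such that $$\max_{1\le i\le 2N-1}|u(x_i)-u_i|\le\begin{cases} C N^{r-2}, & \text{if } r>\tfrac23,\\ C N^{r-2}\ln N, & \text{if } r=\tfrac23,\\ C N^{-2r}, & \text{if } 0<r<\tfrac23.\end{cases}$$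
   Context: Graded mesh: for $r>0$ and a positive integer $N$, $x_j=a+\frac{b-a}{2}\left(\frac jN\right)^r$ for $j=0,1,\dots,N$ and $x_j=b-\frac{b-a}{2}\left(2-\frac jN\right)^r$ for $j=N+1,\dots,2N$. Hat functions: $\phi_j$, $0\le j\le 2N$, is the continuous function on $[a,b]$ that is affine on each $[x_{k-1},x_k]$ and satisfies $\phi_j(x_k)=\delta_{jk}$. Collocation scheme: $A=(a_{i,k})\in\mathbb{R}^{(2N-1)\times(2N-1)}$ with $a_{i,k}=\int_a^b\frac{\phi_k(x_i)-\phi_k(y)}{|x_i-y|^\alpha}\,dy$ for $i,k=1,\dots,2N-1$; $F=(f(x_1),\dots,f(x_{2N-1}))^T$; the scheme is $AU=F$ (the matrix $A$ is nonsingular), and $u_i$ is the approximation of $u(x_i)$. The constant $C$ may depend on $u,\alpha,r,a,b$ but not on $N$. *)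

(* Defs.v *)
From Stdlib Require Import Reals List.
From Stdlib Require Export RList.
From Coquelicot Require Import Coquelicot.
Open Scope R_scope.

(* [Rpower 0 s] is [1] in the standard library (because [ln 0 = 0]), whereas the
   graded mesh needs [0 ^ s = 0] for [s > 0]. *)
Definition rpow (t s : R) : R := if Rlt_dec 0 t then Rpower t s else 0.

Definition Icc (a b : R) (x : R) : Prop := a <= x <= b.

(* [D_in] and [continue_in] only look at points of [Icc a b], so the derivatives
   at [a] and [b] are one-sided. *)
Definition C2_on (a b : R) (u : R -> R) : Prop :=
  exists u1 u2 : R -> R, forall x : R, a <= x <= b ->
    D_in u u1 (Icc a b) x /\ D_in u1 u2 (Icc a b) x /\
    continue_in u2 (Icc a b) x.

(* In all uses below [0 < alpha < 1] and the function is Lipschitz on [a, b], so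
   the integrand is continuous: at [y = x] the quotient [0 / 0] evaluates to
   [0], which is also the limit there. *)
Definition kernel_int (a b alpha : R) (v : R -> R) (x : R) : R :=
  RInt (fun y => (v x - v y) / rpow (Rabs (x - y)) alpha) a b.

Definition solves_nonlocal (a b alpha : R) (f u : R -> R) : Prop :=
  (forall x : R, a < x < b ->
     - RInt (fun y => (u y - u x) / rpow (Rabs (x - y)) alpha) a b = f x) /\
  (forall x : R, ~ (a < x < b) -> u x = 0).

Definition mesh (a b r : R) (N j : nat) : R :=
  if Nat.leb j N
  then a + (b - a) / 2 * rpow (INR j / INR N) r
  else b - (b - a) / 2 * rpow (2 - INR j / INR N) r.

Definition is_hat (a b r : R) (N j : nat) (phi : R -> R) : Prop :=
  (forall y : R, a <= y <= b -> continue_in phi (Icc a b) y) /\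
  (forall k : nat, (1 <= k <= 2 * N)%nat ->
     exists c d : R, forall y : R,
       mesh a b r N (k - 1) <= y <= mesh a b r N k -> phi y = c * y + d) /\
  (forall k : nat, (k <= 2 * N)%nat ->
     phi (mesh a b r N k) = if Nat.eqb j k then 1 else 0).

(* Coquelicot matrices are indexed from 0: the entry at [(i, k)] is the one
   written a_{i+1,k+1} when the interior mesh points are numbered
   1, ..., 2N-1. *)
Definition colloc_matrix (a b alpha r : R) (N : nat) (phi : nat -> R -> R)
  : @matrix R (2 * N - 1) (2 * N - 1) :=
  mk_matrix (2 * N - 1) (2 * N - 1)
    (fun i k => kernel_int a b alpha (phi (S k)) (mesh a b r N (S i))).

Definition colloc_rhs (a b r : R) (N : nat) (f : R -> R)
  : @matrix R (2 * N - 1) 1 :=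
  mk_matrix (2 * N - 1) 1 (fun i _ => f (mesh a b r N (S i))).

(* The list runs over the indices i = 1, ..., 2N-1; the list is nonempty for
   [1 <= N], so [MaxRlist] is its maximum. *)
Definition max_error (a b r : R) (N : nat) (u : R -> R)
    (U : @matrix R (2 * N - 1) 1) : R :=
  MaxRlist (map (fun i => Rabs (u (mesh a b r N i) - coeff_mat 0 U (i - 1) 0))
                (seq 1 (2 * N - 1))).

(* Main.v *)
Require Import Defs.
From Stdlib Require Import Reals List.
From Coquelicot Require Import Coquelicot.
From Stdlib Require Import Lra Lia.
Open Scope R_scope.

(* Let v be the difference between the nodal interpolant of u and the discrete solution.
   Subtracting the two equations, the nonlocal operator applied to v at x_i equals the
   truncation error T_i, the integral of the interpolation error against the kernel.
   With d_i the distance from x_i to the boundary, looking only at the outermost cell at a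
   maximum of v gives max v * h_1 * d_i^(-alpha) <= 4 T_i, where h_1 ~ N^(-r).
   Conversely T_i <= C E d_i^(-alpha), where E bounds both the sum of h_m^3 and the
   products h_m^2 d_i over the cells m at distance less than d_i / 2 from x_i: far cells
   see a kernel of size d_i^(-alpha), and the near ones together carry kernel mass
   d_i^(1 - alpha). The factors d_i^(-alpha) cancel, so the error is O(N^r E).
   Since h_m <= C N^(-r) m^(r-1), E reduces to the sum of N^(-3r) m^(3r-3), which is
   N^(-2), N^(-2) ln N or N^(-3r) according to the position of r relative to 2/3. *)

(** * Power inequalities *)

(** The products [h_m^2 d_i] are controlled without comparing the indices [m] and [i]. With [m]
    counted from the endpoint of its own half of the mesh, a cell that comes within [d_i / 2] of
    [x_i] reaches farther than [d_i / 2] from that endpoint, so [d_i] is at most a multiple of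
    [(m / N)^r] and [h_m^2 d_i] at most a multiple of [N^(-3r) m^(3r-2)]. This is [m] times the
    [m]-th term of the sum of cubes; its maximum over [m] is of order [N^(-2)] for [r >= 2/3] and
    [N^(-3r)] below, never worse than the sum, so a single [E] serves both contributions. The
    singularity and the summation are treated by one device: every cell bound is the increment of an
    explicit function of the node, namely a discrete antiderivative of [m^(3r-3)] plus a truncated
    primitive of the kernel. The increments telescope, and no finite sum has to be estimated.
    Truncating at radius [d_i / 2] leaves outside it a kernel bounded by [(d_i / 2)^(-alpha)], and
    inside it a total mass of order [d_i^(1-alpha)], whose extra factor [d_i] pays for the division
    by [d_i] in the weight [E / d_i] of the near cells. *)

Lemma Rpower_gt0 (x p : R) : 0 < Rpower x p.
Proof. apply exp_pos. Qed.

Lemma ln_le_sub1 (x : R) : 0 < x -> ln x <= x - 1.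
Proof.
intros Hx. pose proof (exp_ineq1_le (ln x)) as H.
rewrite exp_ln in H by assumption. lra.
Qed.

(** Jensen's inequality for [ln] at the points [x] and [1] with weights [p] and [1 - p]: their mean
    is [A], and in the weighted sum of the bounds [ln t <= t - 1] at [t = x / A] and [t = 1 / A] the
    right-hand sides cancel. *)
Lemma bernoulli_concave (x p : R) :
  0 < x -> 0 <= p <= 1 -> Rpower x p <= 1 + p * (x - 1).
Proof.
intros Hx Hp.
assert (HA : 0 < 1 + p * (x - 1)) by nra.
set (A := 1 + p * (x - 1)) in *.
assert (Hle : p * ln x <= ln A).
{ assert (H1 : ln (x / A) <= x / A - 1)
    by (apply ln_le_sub1; apply Rdiv_lt_0_compat; assumption).
  assert (H2 : ln (/ A) <= / A - 1)
    by (apply ln_le_sub1; apply Rinv_0_lt_compat; assumption).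
  rewrite ln_div in H1 by assumption. rewrite ln_Rinv in H2 by assumption.
  assert (H3 : p * (x / A - 1) + (1 - p) * (/ A - 1) = 0)
    by (unfold A in *; field; lra).
  nra. }
unfold Rpower. rewrite <- (exp_ln A) by assumption.
destruct Hle as [Hlt | ->]; [left; apply exp_increasing; assumption | right; reflexivity].
Qed.

(** The concave case for the base [x^p] and the exponent [1 / p], solved for [x^p]. *)
Lemma bernoulli_convex (x p : R) :
  0 < x -> 1 <= p -> 1 + p * (x - 1) <= Rpower x p.
Proof.
intros Hx Hp.
assert (H : Rpower (Rpower x p) (/ p) <= 1 + / p * (Rpower x p - 1)).
{ apply bernoulli_concave; [apply Rpower_gt0|].
  split; [left; apply Rinv_0_lt_compat; lra|].
  rewrite <- Rinv_1. apply Rinv_le_contravar; lra. }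
rewrite Rpower_mult, Rinv_r, Rpower_1 in H by lra.
apply Rmult_le_compat_l with (r := p) in H; [|lra].
rewrite Rmult_plus_distr_l, <- Rmult_assoc, Rinv_r in H by lra. lra.
Qed.

Lemma bernoulli_neg (x s : R) :
  0 < x -> 0 <= s -> 1 + s * (1 - x) <= Rpower x (- s).
Proof.
intros Hx Hs. unfold Rpower.
pose proof (exp_ineq1_le (- s * ln x)). pose proof (ln_le_sub1 x Hx). nra.
Qed.

Lemma rpow_pos (t s : R) : 0 < t -> rpow t s = Rpower t s.
Proof. intros H. unfold rpow. destruct (Rlt_dec 0 t); [reflexivity|lra]. Qed.

Lemma rpow_npos (t s : R) : t <= 0 -> rpow t s = 0.
Proof. intros H. unfold rpow. destruct (Rlt_dec 0 t); [lra|reflexivity]. Qed.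

Lemma rpow_ge0 (t s : R) : 0 <= rpow t s.
Proof.
unfold rpow. destruct (Rlt_dec 0 t); [left; apply Rpower_gt0|lra].
Qed.

Lemma Rpower_le (x y s : R) : 0 < x <= y -> 0 <= s -> Rpower x s <= Rpower y s.
Proof. intros H Hs. apply Rle_Rpower_l; lra. Qed.

Lemma rpow_le (x y s : R) : x <= y -> 0 <= s -> rpow x s <= rpow y s.
Proof.
intros H Hs. destruct (Rlt_dec 0 x).
- rewrite !rpow_pos by lra. apply Rpower_le; lra.
- rewrite rpow_npos by lra. apply rpow_ge0.
Qed.

Lemma rpow_lt (x y s : R) : 0 <= x < y -> 0 < s -> rpow x s < rpow y s.
Proof.
intros H Hs. rewrite (rpow_pos y) by lra. destruct (Req_dec x 0) as [->|Hx].
- rewrite rpow_npos by lra. apply Rpower_gt0.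
- rewrite rpow_pos by lra. apply Rlt_Rpower_l; lra.
Qed.

Lemma is_derive_Rpower (s t : R) :
  0 < t -> is_derive (fun y => Rpower y s) t (s * Rpower t (s - 1)).
Proof. intros Ht. apply is_derive_Reals. apply derivable_pt_lim_power. exact Ht. Qed.

Lemma is_derive_rpow (s t : R) :
  0 < t -> is_derive (fun y => rpow y s) t (s * Rpower t (s - 1)).
Proof.
intros Ht. apply (is_derive_ext_loc (fun y => Rpower y s)); [|apply is_derive_Rpower, Ht].
exists (mkposreal t Ht). intros y Hy.
unfold ball in Hy; simpl in Hy; unfold AbsRing_ball, abs, minus, plus, opp in Hy; simpl in Hy.
apply Rabs_lt_between in Hy. symmetry; apply rpow_pos. lra.
Qed.

Lemma rpow_small (s : R) (eps : R) : 0 < s -> 0 < eps ->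
  exists d, 0 < d /\ forall t, t < d -> rpow t s < eps.
Proof.
intros Hs He. exists (Rpower eps (/ s)). split; [apply Rpower_gt0|].
intros t Ht. destruct (Rlt_dec 0 t).
- rewrite rpow_pos by assumption.
  replace eps with (Rpower (Rpower eps (/ s)) s).
  + apply Rlt_Rpower_l; lra.
  + rewrite Rpower_mult, Rinv_l, Rpower_1; lra.
- rewrite rpow_npos by lra. assumption.
Qed.

Lemma continuous_eps (f : R -> R) (x : R) :
  (forall eps, 0 < eps -> exists d, 0 < d /\
     forall y, Rabs (y - x) < d -> Rabs (f y - f x) < eps) ->
  continuous f x.
Proof.
intros H. apply continuity_pt_filterlim. intros eps He.
destruct (H eps He) as [d [Hd Hf]]. exists d. split; [exact Hd|].
intros y [_ Hy]. apply Hf. exact Hy.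
Qed.

Lemma continuous_rpow (s t : R) : 0 < s -> continuous (fun y => rpow y s) t.
Proof.
intros Hs. destruct (Rlt_dec 0 t) as [Ht|Ht].
- apply (ex_derive_continuous (fun y => rpow y s)). eexists. apply is_derive_rpow, Ht.
- apply continuous_eps. intros eps He. destruct (rpow_small s eps Hs He) as [d [Hd H]].
  exists d. split; [exact Hd|]. intros y Hy. rewrite (rpow_npos t) by lra.
  rewrite Rminus_0_r, Rabs_pos_eq by apply rpow_ge0. apply H.
  apply Rabs_lt_between in Hy. lra.
Qed.

Lemma Rpower_le_exponent (x s t : R) :
  0 < x <= 1 -> s <= t -> Rpower x t <= Rpower x s.
Proof.
intros Hx Hst. unfold Rpower.
assert (ln x <= 0) by (pose proof (ln_le_sub1 x ltac:(lra)); lra).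
destruct (Req_dec (t * ln x) (s * ln x)) as [->|]; [lra|].
left. apply exp_increasing. nra.
Qed.

Lemma INR_pred_scale (m : nat) : (2 <= m)%nat ->
  0 < INR m /\ 0 < / INR m <= / 2 /\ INR (m - 1) = INR m * (1 - / INR m).
Proof.
intros Hm. assert (HM : 2 <= INR m) by (apply (le_INR 2); exact Hm).
repeat split; [lra|apply Rinv_0_lt_compat; lra|apply Rinv_le_contravar; lra|].
rewrite minus_INR by lia. simpl (INR 1). field. lra.
Qed.

Lemma Rpower_sub1 (x p : R) : 0 < x -> Rpower x (p - 1) = / x * Rpower x p.
Proof.
intros Hx. unfold Rminus. rewrite Rpower_plus, Rpower_Ropp, Rpower_1 by lra.
apply Rmult_comm.
Qed.

(* Discrete antiderivatives of [m ^ q] for [q > -1], [q = -1] and [q < -1]. *)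
Lemma power_increment_gt (p : R) (m : nat) : 0 < p -> (1 <= m)%nat ->
  Rpower (INR m) (p - 1)
    <= / Rmin 1 p * (rpow (INR m) p - rpow (INR (m - 1)) p).
Proof.
(* After division by [m^p] the claim is [(1 - 1/m)^p <= 1 - q/m]: Bernoulli for [p <= 1], and for
   [p >= 1] comparison with the exponent [1]. The minimum covers both. *)
intros Hp Hm. set (q := Rmin 1 p).
assert (Hq : 0 < q <= 1)
  by (unfold q; split; [apply Rmin_glb_lt; lra|apply Rmin_l]).
apply Rmult_le_reg_l with q; [lra|].
rewrite <- (Rmult_assoc q (/ q)), Rinv_r, Rmult_1_l by lra.
assert (HM : 1 <= INR m) by (apply (le_INR 1); exact Hm).
rewrite Rpower_sub1, (rpow_pos (INR m)) by lra.
pose proof (Rpower_gt0 (INR m) p) as HG.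
destruct (Nat.eq_dec m 1) as [->|H1].
- simpl in *. rewrite rpow_npos, Rinv_1 by lra. nra.
- destruct (INR_pred_scale m ltac:(lia)) as [_ [Hi Ex]].
  rewrite rpow_pos by (rewrite Ex; nra).
  rewrite Ex, <- Rpower_mult_distr by lra.
  set (x := 1 - / INR m) in *.
  assert (Hb : Rpower x p <= 1 - q * / INR m).
  { unfold q. destruct (Rle_dec 1 p).
    - rewrite Rmin_left by lra.
      pose proof (Rpower_le_exponent x 1 p ltac:(unfold x; lra) ltac:(lra)) as H.
      rewrite Rpower_1 in H by (unfold x; lra). unfold x in *; lra.
    - rewrite Rmin_right by lra.
      pose proof (bernoulli_concave x p ltac:(unfold x; lra) ltac:(lra)) as H.
      unfold x in *; lra. }
  nra.
Qed.

Lemma power_increment_log (m : nat) : (2 <= m)%nat ->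
  / INR m <= ln (INR m) - ln (INR (m - 1)).
Proof.
intros Hm. destruct (INR_pred_scale m Hm) as [H0 [Hi ->]].
rewrite ln_mult by lra.
pose proof (ln_le_sub1 (1 - / INR m) ltac:(lra)). lra.
Qed.

Lemma power_increment_lt (s : R) (m : nat) : 0 < s -> (2 <= m)%nat ->
  Rpower (INR m) (- s - 1)
    <= / s * (Rpower (INR (m - 1)) (- s) - Rpower (INR m) (- s)).
Proof.
intros Hs Hm. destruct (INR_pred_scale m Hm) as [H0 [Hi ->]].
apply Rmult_le_reg_l with s; [lra|].
rewrite <- (Rmult_assoc s (/ s)), Rinv_r, Rmult_1_l by lra.
rewrite Rpower_sub1, <- Rpower_mult_distr by lra.
pose proof (bernoulli_neg (1 - / INR m) s ltac:(lra) ltac:(lra)) as Hb.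
pose proof (Rpower_gt0 (INR m) (- s)) as HG.
nra.
Qed.

(** Source of the cell width bound. Divided by [m^r] it reads [1 - (1 - 1/m)^r <= max(1, r) / m]:
    convex Bernoulli for [r >= 1], comparison with the exponent [1] otherwise. At [m = 1] the lower
    node is [0], where the scaling of powers breaks down, hence the separate case. *)
Lemma power_step_le (r : R) (m : nat) : 0 < r -> (1 <= m)%nat ->
  rpow (INR m) r - rpow (INR (m - 1)) r <= Rmax 1 r * Rpower (INR m) (r - 1).
Proof.
intros Hr Hm.
assert (HM : 1 <= INR m) by (apply (le_INR 1); exact Hm).
rewrite Rpower_sub1, (rpow_pos (INR m)) by lra.
pose proof (Rpower_gt0 (INR m) r) as HG.
destruct (Nat.eq_dec m 1) as [->|H1].
- simpl in *. rewrite rpow_npos, Rinv_1 by lra. pose proof (Rmax_l 1 r). nra.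
- destruct (INR_pred_scale m ltac:(lia)) as [_ [Hi Ex]].
  rewrite rpow_pos by (rewrite Ex; nra).
  rewrite Ex, <- Rpower_mult_distr by lra.
  set (x := 1 - / INR m) in *.
  assert (Hb : 1 - Rmax 1 r * / INR m <= Rpower x r).
  { destruct (Rle_dec 1 r).
    - rewrite Rmax_right by lra.
      pose proof (bernoulli_convex x r ltac:(unfold x; lra) ltac:(lra)).
      unfold x in *; lra.
    - rewrite Rmax_left by lra.
      pose proof (Rpower_le_exponent x r 1 ltac:(unfold x; lra) ltac:(lra)) as H.
      rewrite Rpower_1 in H by (unfold x; lra). unfold x in *; lra. }
  nra.
Qed.

(** * Lipschitz functions and the nonlocal operator *)

(** Composition with this 1-Lipschitz retraction extends a function from [[a, b]] to the line, so
    that data known only on [[a, b]] yield continuity everywhere and two-sided derivatives inside,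
    while integrals over [[a, b]] are unchanged. *)
Definition clip (a b y : R) : R := Rmax a (Rmin b y).

Lemma clip_id (a b y : R) : a <= y <= b -> clip a b y = y.
Proof. intros H. unfold clip. rewrite Rmin_right, Rmax_right; lra. Qed.

Lemma clip_in (a b y : R) : a <= b -> a <= clip a b y <= b.
Proof.
intros H. unfold clip. split; [apply Rmax_l|].
apply Rmax_lub; [exact H|apply Rmin_l].
Qed.

Lemma clip_dist (a b y z : R) : Rabs (clip a b y - clip a b z) <= Rabs (y - z).
Proof.
unfold clip, Rmin. destruct (Rle_dec b y), (Rle_dec b z); unfold Rmax;
  repeat match goal with |- context [Rle_dec ?u ?v] => destruct (Rle_dec u v) end;
  unfold Rabs; repeat match goal with |- context [Rcase_abs ?u] => destruct (Rcase_abs u) end;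
  lra.
Qed.

Definition lipschitz_on (a b K : R) (g : R -> R) : Prop :=
  forall y z, a <= y <= b -> a <= z <= b -> Rabs (g y - g z) <= K * Rabs (y - z).

Definition lipschitz (K : R) (g : R -> R) : Prop :=
  forall y z, Rabs (g y - g z) <= K * Rabs (y - z).

Lemma lipschitz_clip (a b K : R) (g : R -> R) : a <= b -> 0 <= K ->
  lipschitz_on a b K g -> lipschitz K (fun y => g (clip a b y)).
Proof.
intros Hab HK H y z. eapply Rle_trans; [apply H; apply clip_in, Hab|].
apply Rmult_le_compat_l; [exact HK|apply clip_dist].
Qed.

Lemma lipschitz_on_sub (a b K1 K2 : R) (g1 g2 : R -> R) :
  lipschitz_on a b K1 g1 -> lipschitz_on a b K2 g2 ->
  lipschitz_on a b (K1 + K2) (fun y => g1 y - g2 y).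
Proof.
intros H1 H2 y z Hy Hz. specialize (H1 y z Hy Hz). specialize (H2 y z Hy Hz).
replace (g1 y - g2 y - (g1 z - g2 z)) with ((g1 y - g1 z) + - (g2 y - g2 z)) by ring.
eapply Rle_trans; [apply Rabs_triang|]. rewrite Rabs_Ropp. lra.
Qed.

Lemma lipschitz_continuous (K : R) (g : R -> R) (x : R) :
  lipschitz K g -> continuous g x.
Proof.
intros H. apply continuous_eps. intros eps He.
pose proof (Rabs_pos K) as HK.
exists (eps / (Rabs K + 1)). split; [apply Rdiv_lt_0_compat; lra|].
intros y Hy. apply Rle_lt_trans with ((Rabs K + 1) * Rabs (y - x)).
- eapply Rle_trans; [apply H|]. apply Rmult_le_compat_r; [apply Rabs_pos|].
  pose proof (Rle_abs K). lra.
- apply Rlt_le_trans with ((Rabs K + 1) * (eps / (Rabs K + 1))).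
  + apply Rmult_lt_compat_l; [lra|exact Hy].
  + right. field. lra.
Qed.

Definition quotient (alpha : R) (g : R -> R) (x y : R) : R :=
  (g x - g y) / rpow (Rabs (x - y)) alpha.

Lemma quotient_bound (alpha K x y : R) (g : R -> R) :
  0 <= K -> lipschitz K g ->
  Rabs (quotient alpha g x y) <= K * rpow (Rabs (x - y)) (1 - alpha).
Proof.
intros HK H. unfold quotient. destruct (Req_dec x y) as [->|Hxy].
- rewrite Rminus_diag, Rdiv_0_l, Rabs_R0.
  apply Rmult_le_pos; [exact HK|apply rpow_ge0].
- assert (Hp : 0 < Rabs (x - y)) by (apply Rabs_pos_lt; lra).
  rewrite !rpow_pos by exact Hp.
  pose proof (Rpower_gt0 (Rabs (x - y)) alpha) as HP.
  unfold Rdiv. rewrite Rabs_mult, (Rabs_pos_eq (/ _))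
    by (left; apply Rinv_0_lt_compat, HP).
  unfold Rminus at 4. rewrite Rpower_plus, Rpower_Ropp, Rpower_1 by exact Hp.
  rewrite <- Rmult_assoc. apply Rmult_le_compat_r;
    [left; apply Rinv_0_lt_compat, HP|apply H].
Qed.

(** The only delicate point is [y = x]: there the Lipschitz bound leaves the positive power
    [1 - alpha] of the distance, so the limit is [0], which is also the value taken by [0 / 0]. *)
Lemma continuous_quotient (alpha K x y : R) (g : R -> R) :
  0 < alpha < 1 -> 0 <= K -> lipschitz K g -> continuous (quotient alpha g x) y.
Proof.
intros Ha HK H. destruct (Req_dec y x) as [->|Hxy].
- apply continuous_eps. intros eps He.
  destruct (rpow_small (1 - alpha) (eps / (K + 1)) ltac:(lra)
              ltac:(apply Rdiv_lt_0_compat; lra)) as [d [Hd Hs]].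
  exists d. split; [exact Hd|]. intros y Hy.
  assert (E : quotient alpha g x x = 0)
    by (unfold quotient; rewrite Rminus_diag; apply Rdiv_0_l).
  rewrite E, Rminus_0_r. eapply Rle_lt_trans; [apply quotient_bound; eassumption|].
  rewrite Rabs_minus_sym. specialize (Hs _ Hy).
  pose proof (rpow_ge0 (Rabs (y - x)) (1 - alpha)).
  apply Rle_lt_trans with ((K + 1) * rpow (Rabs (y - x)) (1 - alpha)); [nra|].
  apply Rlt_le_trans with ((K + 1) * (eps / (K + 1))).
  + apply Rmult_lt_compat_l; lra.
  + right. field. lra.
- unfold quotient, Rdiv.
  apply (continuous_mult (fun y => g x - g y)).
  + apply (continuous_minus (fun _ => g x) g); [apply continuous_const|].
    eapply lipschitz_continuous, H.
  + apply continuous_Rinv_comp.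
    * apply (continuous_comp (fun y => Rabs (x - y)) (fun t => rpow t alpha));
        [|apply continuous_rpow; lra].
      apply (continuous_comp (fun y => x - y) Rabs); [|apply continuous_Rabs].
      apply (continuous_minus (fun _ => x) (fun y => y));
        [apply continuous_const|apply continuous_id].
    * rewrite rpow_pos by (apply Rabs_pos_lt; lra).
      apply Rgt_not_eq, Rpower_gt0.
Qed.

Lemma ex_RInt_continuous_everywhere (f : R -> R) (p q : R) :
  (forall y, continuous f y) -> ex_RInt f p q.
Proof. intros H. apply (ex_RInt_continuous (V := R_CompleteNormedModule)). intros z _. apply H. Qed.

Lemma quotient_clip (a b alpha x y : R) (g : R -> R) :
  a <= x <= b -> a <= y <= b ->
  quotient alpha (fun z => g (clip a b z)) x y = quotient alpha g x y.
Proof. intros Hx Hy. unfold quotient. rewrite !clip_id by assumption. reflexivity. Qed.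

Lemma kernel_int_clip (a b alpha x : R) (g : R -> R) : a <= x <= b ->
  kernel_int a b alpha g x
    = RInt (quotient alpha (fun z => g (clip a b z)) x) a b.
Proof.
intros Hx. unfold kernel_int. apply (RInt_ext (V := R_CompleteNormedModule)).
intros y Hy. rewrite Rmin_left, Rmax_right in Hy by lra.
rewrite quotient_clip by lra. reflexivity.
Qed.

Lemma ex_kernel_int (a b alpha K x : R) (g : R -> R) :
  0 < alpha < 1 -> a <= x <= b -> 0 <= K -> lipschitz_on a b K g ->
  ex_RInt (quotient alpha g x) a b.
Proof.
intros Ha Hx HK H.
apply (ex_RInt_ext (quotient alpha (fun z => g (clip a b z)) x)).
- intros y Hy. rewrite Rmin_left, Rmax_right in Hy by lra. apply quotient_clip; lra.
- apply ex_RInt_continuous_everywhere. intros y. apply (continuous_quotient alpha K);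
    [exact Ha|exact HK|apply lipschitz_clip; [lra|exact HK|exact H]].
Qed.

Lemma kernel_int_sub (a b alpha K1 K2 x : R) (g1 g2 : R -> R) :
  0 < alpha < 1 -> a <= x <= b -> 0 <= K1 -> 0 <= K2 ->
  lipschitz_on a b K1 g1 -> lipschitz_on a b K2 g2 ->
  kernel_int a b alpha (fun y => g1 y - g2 y) x
    = kernel_int a b alpha g1 x - kernel_int a b alpha g2 x.
Proof.
intros Ha Hx HK1 HK2 H1 H2.
pose proof (ex_kernel_int a b alpha K1 x g1 Ha Hx HK1 H1) as E1.
pose proof (ex_kernel_int a b alpha K2 x g2 Ha Hx HK2 H2) as E2.
pose proof (RInt_minus (V := R_CompleteNormedModule) _ _ a b E1 E2) as E.
etransitivity; [|exact E]. unfold kernel_int.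
apply (RInt_ext (V := R_CompleteNormedModule)). intros y _.
unfold minus, plus, opp, quotient, Rdiv; simpl. ring.
Qed.

(** * One-sided derivatives and the interpolation error of a C^2 function *)

Lemma continuous_clip (a b : R) (g : R -> R) (y : R) : a <= b ->
  (forall x, a <= x <= b -> continue_in g (Icc a b) x) ->
  continuous (fun z => g (clip a b z)) y.
Proof.
intros Hab H. apply continuous_eps. intros eps He.
destruct (H (clip a b y) (clip_in a b y Hab) eps He) as [d [Hd Hg]].
exists d. split; [exact Hd|]. intros z Hz.
destruct (Req_dec (clip a b y) (clip a b z)) as [<-|Hne].
- rewrite Rminus_diag, Rabs_R0. exact He.
- apply Hg. split; [split; [apply clip_in, Hab|exact Hne]|].
  eapply Rle_lt_trans; [apply clip_dist|exact Hz].
Qed.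

Lemma is_derive_clip (a b x : R) (g d : R -> R) :
  a < x < b -> D_in g d (Icc a b) x ->
  is_derive (fun z => g (clip a b z)) x (d x).
Proof.
intros Hx H. apply is_derive_Reals. intros eps He.
destruct (H eps He) as [del [Hdel Hg]].
assert (Hm : 0 < Rmin del (Rmin (x - a) (b - x)))
  by (repeat apply Rmin_glb_lt; lra).
exists (mkposreal _ Hm). simpl. intros h Hh Hlt.
pose proof (Rmin_l del (Rmin (x - a) (b - x))).
pose proof (Rmin_r del (Rmin (x - a) (b - x))).
pose proof (Rmin_l (x - a) (b - x)). pose proof (Rmin_r (x - a) (b - x)).
assert (Hh2 : - Rmin del (Rmin (x - a) (b - x)) < h < Rmin del (Rmin (x - a) (b - x)))
  by (apply Rabs_lt_between, Hlt).
rewrite !clip_id by lra.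
specialize (Hg (x + h)). simpl in Hg. unfold Rdist in Hg.
replace (x + h - x) with h in Hg by ring. apply Hg.
split; [split; [unfold Icc; lra|lra]|lra].
Qed.

(** The mean value theorem asks for derivatives only in the open interval and for continuity at its
    ends, and the clipped function has both. *)
Lemma mean_value_Icc (a b p q : R) (g d : R -> R) :
  (forall x, a <= x <= b -> D_in g d (Icc a b) x) ->
  a <= p -> p <= q -> q <= b ->
  exists c, p <= c <= q /\ g q - g p = d c * (q - p).
Proof.
intros H Hp Hpq Hq.
destruct (MVT_gen (fun z => g (clip a b z)) p q d) as [c [Hc E]].
- intros x Hx. rewrite Rmin_left, Rmax_right in Hx by lra.
  apply is_derive_clip; [lra|apply H; lra].
- intros x _. apply continuity_pt_filterlim. apply continuous_clip; [lra|].
  intros z Hz. eapply cont_deriv, H, Hz.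
- rewrite Rmin_left, Rmax_right in Hc by lra. rewrite !clip_id in E by lra.
  exists c. split; assumption.
Qed.

Lemma continue_in_bounded (a b : R) (g : R -> R) : a <= b ->
  (forall x, a <= x <= b -> continue_in g (Icc a b) x) ->
  exists M, 0 <= M /\ forall x, a <= x <= b -> Rabs (g x) <= M.
Proof.
intros Hab H.
destruct (continuity_ab_maj (fun z => Rabs (g (clip a b z))) a b Hab) as [m [Hm _]].
- intros c _. apply continuity_pt_filterlim.
  apply (continuous_comp (fun z => g (clip a b z)) Rabs);
    [apply continuous_clip; assumption|apply continuous_Rabs].
- exists (Rabs (g (clip a b m))). split; [apply Rabs_pos|].
  intros x Hx. specialize (Hm x Hx). simpl in Hm. rewrite clip_id in Hm by exact Hx.
  exact Hm.
Qed.

Lemma mean_value_lipschitz (a b M : R) (g d : R -> R) :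
  (forall x, a <= x <= b -> D_in g d (Icc a b) x) ->
  (forall x, a <= x <= b -> Rabs (d x) <= M) ->
  lipschitz_on a b M g.
Proof.
intros HD HM y z Hy Hz.
assert (Hw : forall p q, a <= p -> p <= q -> q <= b ->
          Rabs (g q - g p) <= M * Rabs (q - p)).
{ intros p q Hp Hpq Hq.
  destruct (mean_value_Icc a b p q g d HD Hp Hpq Hq) as [c [Hc ->]].
  rewrite Rabs_mult. apply Rmult_le_compat_r; [apply Rabs_pos|apply HM; lra]. }
destruct (Rle_dec z y).
- apply Hw; lra.
- rewrite (Rabs_minus_sym (g y)), (Rabs_minus_sym y). apply Hw; lra.
Qed.

(** The chord slopes over [[p, q]] and [[p, y]] are values of [u'] at points [c] and [c'] of
    [[p, q]], so the error is [(u'(c') - u'(c)) (y - p)], and [u'] is Lipschitz with constant [M]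
    bounding [u'']. *)
Lemma C2_interpolation_error (a b : R) (u : R -> R) : a < b -> C2_on a b u ->
  exists K M, 0 <= K /\ 0 <= M /\ lipschitz_on a b K u /\
    forall p q y, a <= p -> p < q -> q <= b -> p <= y <= q ->
      Rabs (u y - (u p + (u q - u p) / (q - p) * (y - p))) <= M * (q - p) ^ 2.
Proof.
intros Hab [u1 [u2 H]].
assert (H1 : forall x, a <= x <= b -> D_in u u1 (Icc a b) x) by (intros; apply H; assumption).
assert (H2 : forall x, a <= x <= b -> D_in u1 u2 (Icc a b) x) by (intros; apply H; assumption).
destruct (continue_in_bounded a b u1) as [K [HK Hu1]];
  [lra|intros x Hx; eapply cont_deriv, H2, Hx|].
destruct (continue_in_bounded a b u2) as [M [HM Hu2]];
  [lra|intros x Hx; apply H, Hx|].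
exists K, M. repeat split; try assumption.
- apply mean_value_lipschitz with u1; assumption.
- intros p q y Hp Hpq Hq Hy.
  destruct (mean_value_Icc a b p q u u1 H1) as [c [Hc Ec]]; try lra.
  destruct (mean_value_Icc a b p y u u1 H1) as [c' [Hc' Ec']]; try lra.
  rewrite Ec. replace (u y) with (u p + u1 c' * (y - p)) by lra.
  replace (u p + u1 c' * (y - p) - (u p + u1 c * (q - p) / (q - p) * (y - p)))
    with ((u1 c' - u1 c) * (y - p)) by (field; lra).
  rewrite Rabs_mult.
  pose proof (mean_value_lipschitz a b M u1 u2 H2 Hu2 c' c ltac:(lra) ltac:(lra)) as HL.
  assert (Hcc : Rabs (c' - c) <= q - p) by (apply Rabs_le; lra).
  rewrite (Rabs_pos_eq (y - p)) by lra.
  replace (M * (q - p) ^ 2) with (M * (q - p) * (q - p)) by ring.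
  apply Rmult_le_compat; [apply Rabs_pos|lra| |lra].
  eapply Rle_trans; [exact HL|]. apply Rmult_le_compat_l; assumption.
Qed.

(** * Integral of the kernel over a cell *)

(** The mean value theorem for [B] minus the running integral of [f]. Differentiability of [B] is
    asked only inside because the primitive of the kernel has infinite slope at a cell end that
    coincides with the singularity. *)
Lemma RInt_le_primitive (f B B' : R -> R) (p q : R) : p <= q ->
  (forall y, continuous f y) ->
  (forall c, p < c < q -> is_derive B c (B' c)) ->
  (forall c, p <= c <= q -> continuous B c) ->
  (forall c, p <= c <= q -> f c <= B' c) ->
  RInt f p q <= B q - B p.
Proof.
intros Hpq Hf HB HcB Hle.
assert (HP : forall c, is_derive (fun t => RInt f p t) c (f c)).
{ intros c. apply (is_derive_RInt f (fun t => RInt f p t) p); [|apply Hf].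
  apply filter_forall. intros t. apply (RInt_correct (V := R_CompleteNormedModule)).
  apply ex_RInt_continuous_everywhere, Hf. }
destruct (MVT_gen (fun t => B t - RInt f p t) p q (fun c => B' c - f c))
  as [c [Hc E]].
- intros c Hc. rewrite Rmin_left, Rmax_right in Hc by lra.
  apply (is_derive_minus B (fun t => RInt f p t)); [apply HB, Hc|apply HP].
- intros c Hc. rewrite Rmin_left, Rmax_right in Hc by lra.
  apply continuity_pt_filterlim, (continuous_minus B (fun t => RInt f p t)); [apply HcB, Hc|].
  apply (ex_derive_continuous (fun t => RInt f p t)). eexists; apply HP.
- rewrite Rmin_left, Rmax_right in Hc by lra.
  rewrite RInt_point in E. unfold zero in E; simpl in E.
  specialize (Hle c Hc). assert (0 <= (B' c - f c) * (q - p)) by nra. lra.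
Qed.

Lemma Rabs_RInt_le_primitive (f B B' : R -> R) (p q : R) : p <= q ->
  (forall y, continuous f y) ->
  (forall c, p < c < q -> is_derive B c (B' c)) ->
  (forall c, p <= c <= q -> continuous B c) ->
  (forall c, p <= c <= q -> Rabs (f c) <= B' c) ->
  Rabs (RInt f p q) <= B q - B p.
Proof.
intros Hpq Hf HB HcB Hle. apply Rabs_le. split.
- pose proof (RInt_opp (V := R_CompleteNormedModule) f p q
    (ex_RInt_continuous_everywhere f p q Hf)) as E.
  enough (H : RInt (fun y => opp (f y)) p q <= B q - B p)
    by (pose proof (eq_ind _ (fun v => v <= B q - B p) H _ E) as H';
        unfold opp in H'; simpl in H'; lra).
  apply RInt_le_primitive with B'; try assumption.
  + intros y. apply (continuous_opp f), Hf.
  + intros c Hc. specialize (Hle c Hc). apply Rabs_le_between in Hle.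
    unfold opp; simpl. lra.
- apply RInt_le_primitive with B'; try assumption.
  intros c Hc. eapply Rle_trans; [apply Rle_abs|apply Hle, Hc].
Qed.

(* The odd primitive of [beta * |t| ^ (beta - 1)], frozen outside [-rho, rho]. *)
Definition clipped_power (rho beta t : R) : R :=
  if Rle_dec 0 t then rpow (Rmin t rho) beta else - rpow (Rmin (- t) rho) beta.

Lemma clipped_power_nonneg (rho beta t : R) : 0 <= t ->
  clipped_power rho beta t = rpow (Rmin t rho) beta.
Proof. intros H. unfold clipped_power. destruct (Rle_dec 0 t); [reflexivity|lra]. Qed.

Lemma clipped_power_nonpos (rho beta t : R) : 0 <= rho -> t <= 0 ->
  clipped_power rho beta t = - rpow (Rmin (- t) rho) beta.
Proof.
intros Hr H. unfold clipped_power. destruct (Rle_dec 0 t); [|reflexivity].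
replace t with 0 by lra. rewrite Ropp_0, Rmin_left, rpow_npos; lra.
Qed.

Lemma clipped_power_bound (rho beta t : R) : 0 < rho -> 0 < beta ->
  - Rpower rho beta <= clipped_power rho beta t <= Rpower rho beta.
Proof.
intros Hr Hb. pose proof (Rpower_gt0 rho beta).
destruct (Rle_dec 0 t);
  [rewrite clipped_power_nonneg by lra|rewrite clipped_power_nonpos by lra].
- pose proof (rpow_ge0 (Rmin t rho) beta).
  pose proof (rpow_le (Rmin t rho) rho beta (Rmin_r _ _) ltac:(lra)) as H1.
  rewrite (rpow_pos rho) in H1 by lra. lra.
- pose proof (rpow_ge0 (Rmin (- t) rho) beta).
  pose proof (rpow_le (Rmin (- t) rho) rho beta (Rmin_r _ _) ltac:(lra)) as H1.
  rewrite (rpow_pos rho) in H1 by lra. lra.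
Qed.

(** By concavity the power lies below its tangent at [t], whose slope [(1 - alpha) t^(-alpha)] is
    largest at [t = rho]. *)
Lemma rpow_increment_far (alpha rho s t : R) : 0 < alpha < 1 -> 0 < rho ->
  rho <= t <= s ->
  rpow s (1 - alpha) - rpow t (1 - alpha)
    <= (1 - alpha) * Rpower rho (- alpha) * (s - t).
Proof.
intros Ha Hr Hts. rewrite !rpow_pos by lra.
pose proof (bernoulli_concave (s / t) (1 - alpha)
  ltac:(apply Rdiv_lt_0_compat; lra) ltac:(lra)) as Hb.
pose proof (Rpower_gt0 t (1 - alpha)) as HG.
apply Rmult_le_compat_l with (r := Rpower t (1 - alpha)) in Hb; [|lra].
rewrite Rpower_mult_distr in Hb by (try apply Rdiv_lt_0_compat; lra).
replace (t * (s / t)) with s in Hb by (field; lra).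
assert (E : Rpower t (1 - alpha) * (s / t - 1) = Rpower t (- alpha) * (s - t)).
{ unfold Rminus at 1. rewrite Rpower_plus, Rpower_1 by lra. field. lra. }
assert (Hm : Rpower t (- alpha) <= Rpower rho (- alpha)).
{ rewrite !Rpower_Ropp. apply Rinv_le_contravar; [apply Rpower_gt0|apply Rpower_le; lra]. }
assert (Hm' : Rpower t (- alpha) * (s - t) <= Rpower rho (- alpha) * (s - t))
  by (apply Rmult_le_compat_r; lra).
nra.
Qed.

(** Splits the kernel mass of [[t, s]] at the radius [rho]: the part beyond is linear in the length,
    the part within is kept exactly by the truncated powers. *)
Lemma rpow_increment (alpha rho s t : R) : 0 < alpha < 1 -> 0 < rho ->
  0 <= t <= s ->
  rpow s (1 - alpha) - rpow t (1 - alpha)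
    <= (1 - alpha) * Rpower rho (- alpha) * (s - t)
       + (rpow (Rmin s rho) (1 - alpha) - rpow (Rmin t rho) (1 - alpha)).
Proof.
intros Ha Hr Hts.
assert (Hc : 0 <= (1 - alpha) * Rpower rho (- alpha))
  by (pose proof (Rpower_gt0 rho (- alpha)); nra).
set (c := (1 - alpha) * Rpower rho (- alpha)) in *.
destruct (Rle_dec rho t).
- rewrite !Rmin_right by lra.
  pose proof (rpow_increment_far alpha rho s t Ha Hr ltac:(lra)). unfold c. lra.
- rewrite (Rmin_left t) by lra. destruct (Rle_dec rho s).
  + rewrite Rmin_right by lra.
    pose proof (rpow_increment_far alpha rho s rho Ha Hr ltac:(lra)).
    assert (c * (s - rho) <= c * (s - t)) by (apply Rmult_le_compat_l; lra).
    unfold c in *. lra.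
  + rewrite Rmin_left by lra. assert (0 <= c * (s - t)) by nra. lra.
Qed.

(** The two [Rmax] are the distances from [x] to the far and the near end of the cell, whichever
    side it lies on; the bound is [W] times the exact kernel mass of the cell, since [g x = 0]
    leaves only [g y] in the numerator. *)
Lemma quotient_cell_integral (alpha K x p q : R) (g : R -> R) (W : R) :
  0 < alpha < 1 -> 0 <= K -> lipschitz K g -> g x = 0 ->
  p < q -> x <= p \/ q <= x ->
  (forall y, p <= y <= q -> Rabs (g y) <= W) ->
  Rabs (RInt (quotient alpha g x) p q)
    <= W / (1 - alpha)
       * (rpow (Rmax (q - x) (x - p)) (1 - alpha)
          - rpow (Rmax (p - x) (x - q)) (1 - alpha)).
Proof.
intros Ha HK Hg Hx Hpq Hside HW.
assert (Hf : forall y, continuous (quotient alpha g x) y)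
  by (intros y; apply continuous_quotient with K; assumption).
assert (HB : forall c, p <= c <= q ->
   Rabs (quotient alpha g x c) <= W * / rpow (Rabs (x - c)) alpha).
{ intros c Hc. unfold quotient, Rdiv. rewrite Rabs_mult, Hx, Rminus_0_l, Rabs_Ropp.
  (* [c] may be the end of the cell that equals [x]; there the convention [/ 0 = 0] makes the weight
     vanish together with the quotient. *)
  assert (H0 : 0 <= / rpow (Rabs (x - c)) alpha).
  { destruct (Rle_lt_or_eq_dec _ _ (rpow_ge0 (Rabs (x - c)) alpha)) as [H|<-].
    - left. apply Rinv_0_lt_compat, H.
    - rewrite Rinv_0. lra. }
  rewrite (Rabs_pos_eq (/ _)) by exact H0.
  apply Rmult_le_compat_r; [exact H0|apply HW, Hc]. }
assert (HD : forall t, 0 < t ->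
   W / (1 - alpha) * ((1 - alpha) * Rpower t (1 - alpha - 1)) = W * / rpow t alpha).
{ intros t Ht. rewrite rpow_pos by exact Ht.
  replace (1 - alpha - 1) with (- alpha) by ring. rewrite Rpower_Ropp.
  field. split; [apply Rgt_not_eq, Rpower_gt0|lra]. }
destruct Hside as [Hl|Hr].
- rewrite !Rmax_left by lra. rewrite Rmult_minus_distr_l.
  apply (Rabs_RInt_le_primitive (quotient alpha g x)
    (fun y => W / (1 - alpha) * rpow (y - x) (1 - alpha))
    (fun y => W * / rpow (Rabs (x - y)) alpha)); [lra|exact Hf| | |exact HB].
  + intros c Hc. rewrite Rabs_minus_sym, Rabs_pos_eq, <- HD by lra.
    apply (is_derive_scal (fun y => rpow (y - x) (1 - alpha))).
    rewrite <- (Rmult_1_l ((1 - alpha) * _)).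
    apply (is_derive_comp (fun t => rpow t (1 - alpha)) (fun y => y - x)).
    * apply is_derive_rpow. lra.
    * auto_derive; [exact I|ring].
  + intros c _. apply (continuous_mult (fun _ => W / (1 - alpha))
       (fun y => rpow (y - x) (1 - alpha))); [apply continuous_const|].
    apply (continuous_comp (fun y => y - x) (fun t => rpow t (1 - alpha)));
      [|apply continuous_rpow; lra].
    apply (continuous_minus (fun y => y) (fun _ => x));
      [apply continuous_id|apply continuous_const].
- rewrite !Rmax_right by lra.
  replace (W / (1 - alpha) * (rpow (x - p) (1 - alpha) - rpow (x - q) (1 - alpha)))
    with (- (W / (1 - alpha)) * rpow (x - q) (1 - alpha)
          - - (W / (1 - alpha)) * rpow (x - p) (1 - alpha)) by ring.
  apply (Rabs_RInt_le_primitive (quotient alpha g x)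
    (fun y => - (W / (1 - alpha)) * rpow (x - y) (1 - alpha))
    (fun y => W * / rpow (Rabs (x - y)) alpha)); [lra|exact Hf| | |exact HB].
  + intros c Hc. rewrite Rabs_pos_eq, <- HD by lra.
    replace (W / (1 - alpha) * ((1 - alpha) * Rpower (x - c) (1 - alpha - 1)))
      with (- (W / (1 - alpha)) * (- 1 * ((1 - alpha) * Rpower (x - c) (1 - alpha - 1))))
      by ring.
    apply (is_derive_scal (fun y => rpow (x - y) (1 - alpha))).
    apply (is_derive_comp (fun t => rpow t (1 - alpha)) (fun y => x - y)).
    * apply is_derive_rpow. lra.
    * auto_derive; [exact I|ring].
  + intros c _. apply (continuous_mult (fun _ => - (W / (1 - alpha)))
       (fun y => rpow (x - y) (1 - alpha))); [apply continuous_const|].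
    apply (continuous_comp (fun y => x - y) (fun t => rpow t (1 - alpha)));
      [|apply continuous_rpow; lra].
    apply (continuous_minus (fun _ => x) (fun y => y));
      [apply continuous_const|apply continuous_id].
Qed.

(** Since [clipped_power] is odd and monotone, one signed increment [D] measures the near mass of
    cells on both sides of [x], so these increments telescope over the whole mesh. *)
Lemma clipped_power_cell (alpha rho x p q : R) : 0 < alpha < 1 -> 0 < rho ->
  p < q -> x <= p \/ q <= x ->
  let D := clipped_power rho (1 - alpha) (q - x)
           - clipped_power rho (1 - alpha) (p - x) in
  0 <= D /\
  rpow (Rmax (q - x) (x - p)) (1 - alpha) - rpow (Rmax (p - x) (x - q)) (1 - alpha)
    <= (1 - alpha) * Rpower rho (- alpha) * (q - p) + D.
Proof.
intros Ha Hr Hpq Hside D.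
assert (Hmono : forall s t, t <= s ->
   rpow (Rmin t rho) (1 - alpha) <= rpow (Rmin s rho) (1 - alpha)).
{ intros s t Hts. apply rpow_le; [|lra]. apply Rle_min_compat_r, Hts. }
destruct Hside as [Hl|Hg]; unfold D.
- rewrite !clipped_power_nonneg, !Rmax_left by lra.
  specialize (Hmono (q - x) (p - x) ltac:(lra)).
  pose proof (rpow_increment alpha rho (q - x) (p - x) Ha Hr ltac:(lra)) as H.
  replace (q - x - (p - x)) with (q - p) in H by ring. lra.
- rewrite !clipped_power_nonpos, !Rmax_right by lra.
  replace (- (q - x)) with (x - q) by ring. replace (- (p - x)) with (x - p) by ring.
  specialize (Hmono (x - p) (x - q) ltac:(lra)).
  pose proof (rpow_increment alpha rho (x - p) (x - q) Ha Hr ltac:(lra)) as H.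
  replace (x - p - (x - q)) with (q - p) in H by ring. lra.
Qed.

(* A cell at distance at least [rho] from [x] contributes nothing to [D]. *)
Lemma clipped_power_far (rho beta x p q : R) : 0 < rho -> p < q ->
  x + rho <= p \/ q <= x - rho ->
  clipped_power rho beta (q - x) = clipped_power rho beta (p - x).
Proof.
intros Hr Hpq [H|H].
- rewrite !clipped_power_nonneg, !Rmin_right by lra. reflexivity.
- rewrite !clipped_power_nonpos, !Rmin_right by lra. reflexivity.
Qed.

(** [A] acts as a discrete antiderivative of the cell bounds. The sequence [z] may decrease, which
    is how the right half of the mesh is traversed inward from [b]. *)
Lemma RInt_telescope (f : R -> R) (z A : nat -> R) (n : nat) :
  (forall y, continuous f y) ->
  (forall m, (m < n)%nat -> Rabs (RInt f (z m) (z (S m))) <= A (S m) - A m) ->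
  Rabs (RInt f (z O) (z n)) <= A n - A O.
Proof.
intros Hf. induction n as [|n IH]; intros H.
- rewrite RInt_point. unfold zero; simpl. rewrite Rabs_R0. lra.
- rewrite <- (RInt_Chasles (V := R_CompleteNormedModule) f (z O) (z n) (z (S n)))
    by (apply ex_RInt_continuous_everywhere, Hf).
  unfold plus; simpl. eapply Rle_trans; [apply Rabs_triang|].
  specialize (IH ltac:(intros m Hm; apply H; lia)). specialize (H n ltac:(lia)). lra.
Qed.

Lemma RInt_ge_part (f : R -> R) (a b p q c : R) :
  (forall y, continuous f y) -> a <= p -> p <= q -> q <= b ->
  (forall y, a <= y <= b -> 0 <= f y) ->
  (forall y, p < y < q -> c <= f y) ->
  c * (q - p) <= RInt f a b.
Proof.
intros Hf Hap Hpq Hqb H0 Hc.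
assert (Hex : forall s t, ex_RInt f s t)
  by (intros; apply ex_RInt_continuous_everywhere, Hf).
rewrite <- (RInt_Chasles (V := R_CompleteNormedModule) f a p b) by apply Hex.
rewrite <- (RInt_Chasles (V := R_CompleteNormedModule) f p q b) by apply Hex.
unfold plus; simpl.
assert (0 <= RInt f a p) by (apply RInt_ge_0; [lra|apply Hex|intros; apply H0; lra]).
assert (0 <= RInt f q b) by (apply RInt_ge_0; [lra|apply Hex|intros; apply H0; lra]).
assert (Hm : RInt (fun _ => c) p q <= RInt f p q)
  by (apply RInt_le; [lra|apply ex_RInt_const|apply Hex|exact Hc]).
rewrite RInt_const in Hm. unfold scal in Hm; simpl in Hm. unfold mult in Hm; simpl in Hm.
lra.
Qed.

(** * Graded mesh and discrete maximum principle *)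

Lemma rpow_ratio (r : R) (m N : nat) : (1 <= N)%nat ->
  rpow (INR m / INR N) r = rpow (INR m) r * Rpower (INR N) (- r).
Proof.
intros HN. assert (H1 : 1 <= INR N) by (apply (le_INR 1); exact HN).
destruct (Nat.eq_dec m 0) as [->|Hm].
- simpl. rewrite Rdiv_0_l, rpow_npos by lra. ring.
- assert (Hm1 : 1 <= INR m) by (apply (le_INR 1); lia).
  rewrite !rpow_pos by (try apply Rdiv_lt_0_compat; lra).
  unfold Rpower, Rdiv. rewrite <- exp_plus. f_equal.
  rewrite ln_mult, ln_Rinv by (try apply Rinv_0_lt_compat; lra). ring.
Qed.

(* Distance from the [m]-th mesh point to the nearest endpoint, [m <= N]. *)
Definition graded (a b r : R) (N m : nat) : R :=
  (b - a) / 2 * (rpow (INR m) r * Rpower (INR N) (- r)).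

Lemma graded_N (a b r : R) (N : nat) : (1 <= N)%nat ->
  graded a b r N N = (b - a) / 2.
Proof.
intros HN. assert (H1 : 1 <= INR N) by (apply (le_INR 1); exact HN).
unfold graded. rewrite rpow_pos, Rpower_Ropp, Rinv_r; [ring|apply Rgt_not_eq, Rpower_gt0|lra].
Qed.

Lemma mesh_left (a b r : R) (N j : nat) : (1 <= N)%nat -> (j <= N)%nat ->
  mesh a b r N j = a + graded a b r N j.
Proof.
intros HN Hj. unfold mesh. rewrite (proj2 (Nat.leb_le j N) Hj), rpow_ratio by exact HN.
reflexivity.
Qed.

(** Counted inward from [b], the right half mirrors the left. The midpoint [m = N] belongs to the
    left branch of [mesh]; the two formulas agree there because each half has length
    [(b - a) / 2]. *)
Lemma mesh_right (a b r : R) (N m : nat) : (1 <= N)%nat -> (m <= N)%nat ->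
  mesh a b r N (2 * N - m) = b - graded a b r N m.
Proof.
intros HN Hm. assert (H1 : 1 <= INR N) by (apply (le_INR 1); exact HN).
destruct (Nat.eq_dec m N) as [->|Hne].
- replace (2 * N - N)%nat with N by lia. rewrite mesh_left, graded_N by lia. field.
- unfold mesh. rewrite (proj2 (Nat.leb_gt (2 * N - m) N)) by lia.
  replace (2 - INR (2 * N - m) / INR N) with (INR m / INR N).
  + rewrite rpow_ratio by exact HN. reflexivity.
  + rewrite minus_INR, mult_INR by lia. simpl (INR 2). field. lra.
Qed.

Lemma graded_0 (a b r : R) (N : nat) : graded a b r N 0 = 0.
Proof. unfold graded. simpl. rewrite rpow_npos by lra. ring. Qed.

Lemma graded_1 (a b r : R) (N : nat) :
  graded a b r N 1 = (b - a) / 2 * Rpower (INR N) (- r).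
Proof.
unfold graded. simpl. rewrite rpow_pos by lra. unfold Rpower at 1.
rewrite ln_1, Rmult_0_r, exp_0. ring.
Qed.

Lemma graded_lt (a b r : R) (N m : nat) : a < b -> 0 < r ->
  graded a b r N m < graded a b r N (S m).
Proof.
intros Hab Hr. unfold graded. apply Rmult_lt_compat_l; [lra|].
apply Rmult_lt_compat_r; [apply Rpower_gt0|]. apply rpow_lt; [|exact Hr].
split; [apply pos_INR|apply lt_INR; lia].
Qed.

Lemma graded_step (a b r : R) (N m : nat) : a < b -> 0 < r -> (1 <= m)%nat ->
  graded a b r N m - graded a b r N (m - 1)
    <= (b - a) / 2 * Rmax 1 r * (Rpower (INR N) (- r) * Rpower (INR m) (r - 1)).
Proof.
intros Hab Hr Hm. pose proof (power_step_le r m Hr Hm) as H.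
pose proof (Rpower_gt0 (INR N) (- r)) as HG. unfold graded.
apply Rmult_le_compat_l with (r := (b - a) / 2 * Rpower (INR N) (- r)) in H; [|nra].
lra.
Qed.

Lemma mesh_lt (a b r : R) (N j : nat) : a < b -> 0 < r -> (1 <= N)%nat ->
  (j < 2 * N)%nat -> mesh a b r N j < mesh a b r N (S j).
Proof.
intros Hab Hr HN Hj. destruct (Nat.le_gt_cases (S j) N) as [H|H].
- rewrite !mesh_left by lia. pose proof (graded_lt a b r N j Hab Hr). lra.
- set (m := (2 * N - S j)%nat).
  replace j with (2 * N - S m)%nat at 1 by lia.
  replace (S j) with (2 * N - m)%nat by lia.
  rewrite !mesh_right by lia. pose proof (graded_lt a b r N m Hab Hr). lra.
Qed.

Lemma mesh_le (a b r : R) (N i j : nat) : a < b -> 0 < r -> (1 <= N)%nat ->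
  (i <= j <= 2 * N)%nat -> mesh a b r N i <= mesh a b r N j.
Proof.
intros Hab Hr HN [Hij Hj]. induction Hij as [|j Hij IH]; [lra|].
specialize (IH ltac:(lia)). pose proof (mesh_lt a b r N j Hab Hr HN ltac:(lia)). lra.
Qed.

Lemma mesh_first (a b r : R) (N : nat) : (1 <= N)%nat -> mesh a b r N 0 = a.
Proof. intros HN. rewrite mesh_left, graded_0 by lia. ring. Qed.

Lemma mesh_last (a b r : R) (N : nat) : (1 <= N)%nat -> mesh a b r N (2 * N) = b.
Proof.
intros HN. replace (2 * N)%nat with (2 * N - 0)%nat by lia.
rewrite mesh_right, graded_0 by lia. ring.
Qed.

Lemma mesh_in (a b r : R) (N j : nat) : a < b -> 0 < r -> (1 <= N)%nat ->
  (j <= 2 * N)%nat -> a <= mesh a b r N j <= b.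
Proof.
intros Hab Hr HN Hj. pose proof (mesh_le a b r N 0 j Hab Hr HN ltac:(lia)) as H1.
pose proof (mesh_le a b r N j (2 * N) Hab Hr HN ltac:(lia)) as H2.
rewrite mesh_first in H1 by exact HN. rewrite mesh_last in H2 by exact HN. lra.
Qed.

Lemma mesh_interior (a b r : R) (N j : nat) : a < b -> 0 < r -> (1 <= N)%nat ->
  (1 <= j <= 2 * N - 1)%nat -> a < mesh a b r N j < b.
Proof.
intros Hab Hr HN Hj.
pose proof (mesh_lt a b r N (j - 1) Hab Hr HN ltac:(lia)) as H1.
replace (S (j - 1)) with j in H1 by lia.
pose proof (mesh_lt a b r N j Hab Hr HN ltac:(lia)) as H2.
pose proof (mesh_in a b r N (j - 1) Hab Hr HN ltac:(lia)).
pose proof (mesh_in a b r N (S j) Hab Hr HN ltac:(lia)). lra.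
Qed.

Lemma mesh_cell (a b r y : R) (N : nat) : a < b -> 0 < r -> (1 <= N)%nat ->
  a <= y <= b ->
  exists k, (1 <= k <= 2 * N)%nat /\ mesh a b r N (k - 1) <= y <= mesh a b r N k.
Proof.
intros Hab Hr HN Hy.
assert (H : forall n, (1 <= n <= 2 * N)%nat -> y <= mesh a b r N n ->
   exists k, (1 <= k <= n)%nat /\ mesh a b r N (k - 1) <= y <= mesh a b r N k).
{ induction n as [|n IH]; intros Hn Hyn; [lia|].
  destruct (Rle_dec (mesh a b r N n) y) as [Hc|Hc].
  - exists (S n). replace (S n - 1)%nat with n by lia. split; [lia|lra].
  - destruct (Nat.eq_dec n 0) as [->|Hn0];
      [rewrite mesh_first in Hc by exact HN; lra|].
    destruct (IH ltac:(lia) ltac:(lra)) as [k [Hk Hky]]. exists k. split; [lia|exact Hky]. }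
apply H; [lia|]. rewrite mesh_last by exact HN. lra.
Qed.

(** * Piecewise affine functions and stability of the scheme *)

Definition piecewise_affine (a b r : R) (N : nat) (v : R -> R) : Prop :=
  forall k : nat, (1 <= k <= 2 * N)%nat ->
    exists c d : R, forall y : R,
      mesh a b r N (k - 1) <= y <= mesh a b r N k -> v y = c * y + d.

(** Adjacent closed cells share a node, so the affine pieces match there, and each cell adds its
    slope to the constant. The resulting [K] depends on [N], but it serves only to make the
    integrands continuous and never enters an error bound. *)
Lemma piecewise_affine_lipschitz (a b r : R) (N : nat) (v : R -> R) :
  a < b -> 0 < r -> (1 <= N)%nat -> piecewise_affine a b r N v ->
  exists K, 0 <= K /\ lipschitz_on a b K v.
Proof.
intros Hab Hr HN Hv.
assert (H : forall n, (n <= 2 * N)%nat ->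
   exists K, 0 <= K /\ lipschitz_on a (mesh a b r N n) K v).
{ induction n as [|n IH]; intros Hn.
  - exists 0. split; [lra|]. intros y z Hy Hz.
    rewrite mesh_first in Hy, Hz by exact HN.
    replace y with z by lra. rewrite !Rminus_diag, Rabs_R0. lra.
  - destruct (IH ltac:(lia)) as [K [HK HL]].
    destruct (Hv (S n) ltac:(lia)) as [c [d Hcd]].
    replace (S n - 1)%nat with n in Hcd by lia.
    set (p := mesh a b r N n) in *. set (q := mesh a b r N (S n)) in *.
    assert (Hpq : p < q) by (apply mesh_lt; try assumption; lia).
    assert (Hap : a <= p) by (apply mesh_in; try assumption; lia).
    exists (K + Rabs c). pose proof (Rabs_pos c) as Hc0. split; [lra|].
    assert (Hw : forall y z, a <= y -> y <= z -> z <= q ->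
              Rabs (v z - v y) <= (K + Rabs c) * Rabs (z - y)).
    { intros y z Hy Hyz Hz. rewrite (Rabs_pos_eq (z - y)) by lra.
      assert (HLip : forall y z, a <= y -> y <= z -> z <= p ->
                Rabs (v z - v y) <= K * (z - y)).
      { intros y' z' H1 H2 H3. specialize (HL z' y' ltac:(lra) ltac:(lra)).
        rewrite (Rabs_pos_eq (z' - y')) in HL by lra. exact HL. }
      assert (Haff : forall y z, p <= y -> y <= z -> z <= q ->
                Rabs (v z - v y) <= Rabs c * (z - y)).
      { intros y' z' H1 H2 H3. rewrite !Hcd by lra.
        replace (c * z' + d - (c * y' + d)) with (c * (z' - y')) by ring.
        rewrite Rabs_mult, (Rabs_pos_eq (z' - y')) by lra. lra. }
      destruct (Rle_dec z p); [specialize (HLip y z ltac:(lra) ltac:(lra) ltac:(lra)); nra|].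
      destruct (Rle_dec p y); [specialize (Haff y z ltac:(lra) ltac:(lra) ltac:(lra)); nra|].
      specialize (HLip y p ltac:(lra) ltac:(lra) ltac:(lra)).
      specialize (Haff p z ltac:(lra) ltac:(lra) ltac:(lra)).
      replace (v z - v y) with ((v z - v p) + (v p - v y)) by ring.
      eapply Rle_trans; [apply Rabs_triang|]. nra. }
    intros y z Hy Hz. destruct (Rle_dec z y).
    + apply Hw; lra.
    + rewrite (Rabs_minus_sym (v y)), (Rabs_minus_sym y). apply Hw; lra. }
destruct (H (2 * N)%nat ltac:(lia)) as [K HK]. rewrite mesh_last in HK by exact HN.
exists K. exact HK.
Qed.

Lemma piecewise_affine_interp (a b r : R) (N k : nat) (v : R -> R) (y : R) :
  a < b -> 0 < r -> (1 <= N)%nat -> piecewise_affine a b r N v ->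
  (1 <= k <= 2 * N)%nat -> mesh a b r N (k - 1) <= y <= mesh a b r N k ->
  v y = v (mesh a b r N (k - 1))
        + (v (mesh a b r N k) - v (mesh a b r N (k - 1)))
          / (mesh a b r N k - mesh a b r N (k - 1)) * (y - mesh a b r N (k - 1)).
Proof.
intros Hab Hr HN Hv Hk Hy. destruct (Hv k Hk) as [c [d H]].
pose proof (mesh_lt a b r N (k - 1) Hab Hr HN ltac:(lia)) as Hlt.
replace (S (k - 1)) with k in Hlt by lia.
rewrite !H by lra. field. lra.
Qed.

Lemma piecewise_affine_le (a b r : R) (N : nat) (v : R -> R) (m y : R) :
  a < b -> 0 < r -> (1 <= N)%nat -> piecewise_affine a b r N v ->
  (forall k, (k <= 2 * N)%nat -> v (mesh a b r N k) <= m) ->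
  a <= y <= b -> v y <= m.
Proof.
intros Hab Hr HN Hv Hm Hy.
destruct (mesh_cell a b r y N Hab Hr HN Hy) as [k [Hk Hky]].
destruct (Hv k Hk) as [c [d H]].
pose proof (mesh_lt a b r N (k - 1) Hab Hr HN ltac:(lia)) as Hlt.
replace (S (k - 1)) with k in Hlt by lia.
pose proof (Hm k ltac:(lia)) as H1. pose proof (Hm (k - 1)%nat ltac:(lia)) as H2.
rewrite H in H1 by lra. rewrite H in H2 by lra. rewrite H by lra.
destruct (Rle_dec 0 c); nra.
Qed.

Lemma piecewise_affine_sub (a b r : R) (N : nat) (v w : R -> R) :
  piecewise_affine a b r N v -> piecewise_affine a b r N w ->
  piecewise_affine a b r N (fun y => v y - w y).
Proof.
intros Hv Hw k Hk. destruct (Hv k Hk) as [c [d H]]. destruct (Hw k Hk) as [c' [d' H']].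
exists (c - c'), (d - d'). intros y Hy. rewrite H, H' by exact Hy. ring.
Qed.

Lemma finite_argmax (g : nat -> R) (n : nat) :
  exists i, (i <= n)%nat /\ forall k, (k <= n)%nat -> g k <= g i.
Proof.
induction n as [|n [i [Hi H]]].
- exists O. split; [lia|]. intros k Hk. replace k with O by lia. lra.
- destruct (Rle_dec (g i) (g (S n))) as [Hc|Hc].
  + exists (S n). split; [lia|]. intros k Hk.
    destruct (Nat.eq_dec k (S n)) as [->|]; [lra|].
    specialize (H k ltac:(lia)). lra.
  + exists i. split; [lia|]. intros k Hk.
    destruct (Nat.eq_dec k (S n)) as [->|]; [lra|]. apply H. lia.
Qed.

Definition boundary_dist (a b x : R) : R := Rmin (x - a) (b - x).

Lemma quotient_lower (alpha d c x y : R) (v : R -> R) :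
  0 < alpha -> 0 <= c <= v x - v y -> 0 < Rabs (x - y) <= d ->
  c * Rpower d (- alpha) <= quotient alpha v x y.
Proof.
intros Ha Hc Hd. unfold quotient, Rdiv. rewrite rpow_pos by lra.
apply Rmult_le_compat; [lra|left; apply Rpower_gt0|lra|].
rewrite Rpower_Ropp. apply Rinv_le_contravar; [apply Rpower_gt0|].
apply Rpower_le; lra.
Qed.

(* At a positive maximum [x] of [v] the integrand is nonnegative, and [v <= v x / 2]
   on the outer half of the boundary cell nearest to [x] because [v] vanishes at the
   endpoint. *)
Lemma discrete_maximum_principle (a b alpha r B : R) (N : nat) (v : R -> R) :
  a < b -> 0 < alpha < 1 -> 0 < r -> (1 <= N)%nat -> 0 <= B ->
  piecewise_affine a b r N v -> v a = 0 -> v b = 0 ->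
  (forall i, (1 <= i <= 2 * N - 1)%nat ->
     kernel_int a b alpha v (mesh a b r N i)
       <= B * Rpower (boundary_dist a b (mesh a b r N i)) (- alpha)) ->
  forall k, (k <= 2 * N)%nat ->
    v (mesh a b r N k) <= 4 * B / graded a b r N 1.
Proof.
intros Hab Ha Hr HN HB Hv Hva Hvb HK k Hk.
set (h := graded a b r N 1).
assert (Hh : 0 < h).
{ pose proof (graded_lt a b r N 0 Hab Hr) as H. rewrite graded_0 in H. exact H. }
destruct (finite_argmax (fun k => v (mesh a b r N k)) (2 * N)) as [i [Hi Hmax]].
apply Rle_trans with (v (mesh a b r N i)); [apply Hmax, Hk|].
set (x := mesh a b r N i) in *.
assert (H0 : 0 <= 4 * B / h) by (apply Rdiv_le_0_compat; lra).
destruct (Rle_dec (v x) 0) as [|Hpos]; [lra|]. apply Rnot_le_gt in Hpos.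
assert (Hi' : (1 <= i <= 2 * N - 1)%nat).
{ assert (i <> O)
    by (intros ->; unfold x in Hpos; rewrite mesh_first in Hpos by exact HN; lra).
  assert (i <> (2 * N)%nat)
    by (intros ->; unfold x in Hpos; rewrite mesh_last in Hpos by exact HN; lra).
  lia. }
pose proof (mesh_interior a b r N i Hab Hr HN Hi') as Hx. fold x in Hx.
specialize (HK i Hi'). fold x in HK. set (d := boundary_dist a b x) in *.
destruct (piecewise_affine_lipschitz a b r N v Hab Hr HN Hv) as [K [HK0 HL]].
pose proof (lipschitz_clip a b K v ltac:(lra) HK0 HL) as HLc.
rewrite kernel_int_clip in HK by lra.
assert (Hf : forall y, continuous (quotient alpha (fun z => v (clip a b z)) x) y)
  by (intros y; apply continuous_quotient with K; assumption).
assert (Hle : forall y, a <= y <= b -> v y <= v x)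
  by (intros y Hy; apply (piecewise_affine_le a b r N); assumption).
assert (Hnn : forall y, a <= y <= b ->
          0 <= quotient alpha (fun z => v (clip a b z)) x y).
{ intros y Hy. rewrite quotient_clip by lra. unfold quotient.
  destruct (Req_dec x y) as [->|Hne]; [rewrite Rminus_diag, Rdiv_0_l; lra|].
  apply Rdiv_le_0_compat; [specialize (Hle y Hy); lra|].
  rewrite rpow_pos by (apply Rabs_pos_lt; lra). apply Rpower_gt0. }
pose proof (Rpower_gt0 d (- alpha)) as HG.
(* Half of the maximum on half of a cell: this is the origin of the factor 4. The chosen half cell
   adjoins the endpoint nearest to [x], hence all its points are within [d] of [x]. *)
assert (Hlow : v x / 2 * Rpower d (- alpha) * (h / 2)
          <= RInt (quotient alpha (fun z => v (clip a b z)) x) a b).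
{ destruct (Nat.le_gt_cases i N) as [HiN|HiN].
  - assert (Ed : d = x - a).
    { unfold d, boundary_dist. apply Rmin_left.
      pose proof (mesh_le a b r N i N Hab Hr HN ltac:(lia)) as H.
      rewrite (mesh_left a b r N N), graded_N in H by lia. fold x in H. lra. }
    pose proof (mesh_le a b r N 1 i Hab Hr HN ltac:(lia)) as H1. fold x in H1.
    rewrite mesh_left in H1 by lia. fold h in H1.
    replace (h / 2) with (a + h / 2 - a) by ring.
    apply RInt_ge_part; [exact Hf|lra|lra|lra|exact Hnn|].
    intros y Hy. rewrite quotient_clip by lra.
    apply quotient_lower; [lra| |rewrite Ed, Rabs_pos_eq; lra].
    pose proof (piecewise_affine_interp a b r N 1 v y Hab Hr HN Hv ltac:(lia)) as Hint.
    replace (1 - 1)%nat with O in Hint by lia.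
    rewrite mesh_first, mesh_left, Hva in Hint by lia. fold h in Hint.
    specialize (Hint ltac:(lra)).
    pose proof (Hle (a + h) ltac:(lra)) as Hm.
    assert (Ht : 0 <= (y - a) / h <= / 2).
    { split; [apply Rdiv_le_0_compat; lra|].
      apply Rmult_le_reg_r with h; [lra|]. unfold Rdiv.
      rewrite Rmult_assoc, Rinv_l by lra. lra. }
    replace (v y) with (v (a + h) * ((y - a) / h)) by (rewrite Hint; field; lra).
    nra.
  - assert (Ed : d = b - x).
    { unfold d, boundary_dist. apply Rmin_right.
      pose proof (mesh_le a b r N N i Hab Hr HN ltac:(lia)) as H.
      rewrite (mesh_left a b r N N), graded_N in H by lia. fold x in H. lra. }
    pose proof (mesh_le a b r N i (2 * N - 1) Hab Hr HN ltac:(lia)) as H1. fold x in H1.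
    rewrite mesh_right in H1 by lia. fold h in H1.
    replace (h / 2) with (b - (b - h / 2)) by ring.
    apply RInt_ge_part; [exact Hf|lra|lra|lra|exact Hnn|].
    intros y Hy. rewrite quotient_clip by lra.
    apply quotient_lower;
      [lra| |rewrite Ed, Rabs_minus_sym, Rabs_pos_eq; lra].
    pose proof (piecewise_affine_interp a b r N (2 * N) v y Hab Hr HN Hv ltac:(lia)) as Hint.
    rewrite mesh_last, mesh_right, Hvb in Hint by lia. fold h in Hint.
    specialize (Hint ltac:(lra)).
    pose proof (Hle (b - h) ltac:(lra)) as Hm.
    assert (Ht : 0 <= (b - y) / h <= / 2).
    { split; [apply Rdiv_le_0_compat; lra|].
      apply Rmult_le_reg_r with h; [lra|]. unfold Rdiv.
      rewrite Rmult_assoc, Rinv_l by lra. lra. }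
    replace (v y) with (v (b - h) * ((b - y) / h)) by (rewrite Hint; field; lra).
    nra. }
apply Rmult_le_reg_r with (h * Rpower d (- alpha)); [nra|].
replace (4 * B / h * (h * Rpower d (- alpha))) with (4 * (B * Rpower d (- alpha)))
  by (field; lra).
lra.
Qed.

(** * Truncation error *)

(** Here [nu], [P], [S] stand for [N^(-r)], [m^(r-1)], [m^r], so that [K nu P] bounds the width [h]
    and [L S nu] is the distance of the inner node of cell [m] from its endpoint. Either the cell is
    far and [D] vanishes, or [delta] is at most twice that distance and [h^2 delta] is bounded
    through [E]. *)
Lemma near_cell_weight (K L nu P S E delta h D : R) :
  0 < nu -> 0 < L -> 0 < P -> 0 < S -> 0 < delta -> 0 <= K ->
  0 < h <= K * (nu * P) -> 0 <= D ->
  D = 0 \/ delta <= 2 * (L * (S * nu)) ->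
  nu ^ 3 * (P ^ 2 * S) <= E ->
  h ^ 2 * D <= 2 * L * K ^ 2 * E / delta * D.
Proof.
intros Hnu HL HP HS Hd HK Hh HD [->|Hn] HE; [lra|].
apply Rmult_le_compat_r; [exact HD|].
apply Rmult_le_reg_r with delta; [exact Hd|].
replace (2 * L * K ^ 2 * E / delta * delta) with (2 * L * K ^ 2 * E) by (field; lra).
assert (Hh2 : h ^ 2 <= (K * (nu * P)) ^ 2) by (apply pow_incr; lra).
assert (H0 : 0 <= h ^ 2) by (apply pow_le; lra).
apply Rle_trans with ((K * (nu * P)) ^ 2 * (2 * (L * (S * nu)))).
- apply Rmult_le_compat; lra.
- replace ((K * (nu * P)) ^ 2 * (2 * (L * (S * nu))))
    with (2 * L * K ^ 2 * (nu ^ 3 * (P ^ 2 * S))) by ring.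
  apply Rmult_le_compat_l; [|exact HE].
  pose proof (pow_le K 2 HK). nra.
Qed.

(* [clipped_power] confines the singular part of the integral to the cells at distance
   less than [rho = delta / 2] from [x]; those have size controlled by [E / delta]. *)
Lemma cell_estimate (alpha K0 K L M nu P S E F delta x p q : R) (w : R -> R) :
  0 < alpha < 1 -> 0 <= K0 -> lipschitz K0 w -> w x = 0 -> 0 <= M ->
  0 < nu -> 0 < L -> 0 < P -> 0 < S -> 0 < delta -> 0 <= K ->
  p < q -> q - p <= K * (nu * P) -> x <= p \/ q <= x ->
  (forall y, p <= y <= q -> Rabs (w y) <= M * (q - p) ^ 2) ->
  (x + delta / 2 <= p \/ q <= x - delta / 2) \/ delta <= 2 * (L * (S * nu)) ->
  nu ^ 3 * (P ^ 2 * S) <= E -> nu ^ 3 * P ^ 3 <= F ->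
  Rabs (RInt (quotient alpha w x) p q)
    <= M * K ^ 3 * Rpower (delta / 2) (- alpha) * F
       + M / (1 - alpha) * (2 * L * K ^ 2 * E / delta)
         * (clipped_power (delta / 2) (1 - alpha) (q - x)
            - clipped_power (delta / 2) (1 - alpha) (p - x)).
Proof.
intros Ha HK0 Hw Hwx HM Hnu HL HP HS Hd HK Hpq Hh Hside HW Hfar HE HF.
eapply Rle_trans;
  [apply (quotient_cell_integral alpha K0 x p q w (M * (q - p) ^ 2)); assumption|].
destruct (clipped_power_cell alpha (delta / 2) x p q Ha ltac:(lra) Hpq Hside) as [HD HC].
set (D := clipped_power (delta / 2) (1 - alpha) (q - x)
          - clipped_power (delta / 2) (1 - alpha) (p - x)) in *.
set (rho := Rpower (delta / 2) (- alpha)) in *.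
assert (Hrho : 0 < rho) by apply Rpower_gt0.
set (h := q - p) in *.
assert (Hh0 : 0 < h) by (unfold h; lra).
assert (HDE : h ^ 2 * D <= 2 * L * K ^ 2 * E / delta * D).
{ apply near_cell_weight with nu P S; try assumption; [lra|].
  destruct Hfar as [Hfar|Hnear]; [left|right; exact Hnear].
  unfold D. rewrite (clipped_power_far (delta / 2) (1 - alpha) x p q); lra. }
assert (Hh3 : h ^ 3 <= K ^ 3 * F).
{ apply Rle_trans with ((K * (nu * P)) ^ 3); [apply pow_incr; lra|].
  replace ((K * (nu * P)) ^ 3) with (K ^ 3 * (nu ^ 3 * P ^ 3)) by ring.
  apply Rmult_le_compat_l; [apply pow_le, HK|exact HF]. }
assert (Hc : 0 <= M * h ^ 2 / (1 - alpha)).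
{ apply Rdiv_le_0_compat; [apply Rmult_le_pos; [exact HM|apply pow_le; lra]|lra]. }
eapply Rle_trans; [apply Rmult_le_compat_l; [exact Hc|exact HC]|].
replace (M * h ^ 2 / (1 - alpha) * ((1 - alpha) * rho * h + D))
  with (M * rho * h ^ 3 + M / (1 - alpha) * (h ^ 2 * D)) by (field; lra).
apply Rplus_le_compat.
- replace (M * K ^ 3 * rho * F) with (M * rho * (K ^ 3 * F)) by ring.
  apply Rmult_le_compat_l; [nra|exact Hh3].
- rewrite Rmult_assoc. apply Rmult_le_compat_l; [|exact HDE].
  apply Rdiv_le_0_compat; lra.
Qed.

(** With [L = (b - a) / 2] and [K = L max(1, r)], the term [K^3] comes from the linear part of the
    kernel masses and [2 L K^2 / (1 - alpha)] from the clipped part. The 4 is a factor 2 for the two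
    halves of the mesh times a factor 2 from [(d/2)^(-alpha) <= 2 d^(-alpha)]. *)
Definition truncation_const (a b alpha r M : R) : R :=
  4 * M * (((b - a) / 2 * Rmax 1 r) ^ 3
           + 2 * ((b - a) / 2) * ((b - a) / 2 * Rmax 1 r) ^ 2 / (1 - alpha)).

(** Each half of the mesh contributes one copy of [Phi N - Phi 0], while the clipped powers
    telescope from [a] to [b] and leave at most [2 (d/2)^(1-alpha)], that is [d (d/2)^(-alpha)];
    this [d] cancels the one dividing [E]. *)
Lemma truncation_bound (a b alpha r K0 M E : R) (Phi : nat -> R) (N i : nat)
    (w : R -> R) :
  a < b -> 0 < alpha < 1 -> 0 < r -> (1 <= N)%nat ->
  0 <= K0 -> lipschitz K0 w -> 0 <= M ->
  (forall k, (1 <= k <= 2 * N)%nat -> forall y,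
     mesh a b r N (k - 1) <= y <= mesh a b r N k ->
     Rabs (w y) <= M * (mesh a b r N k - mesh a b r N (k - 1)) ^ 2) ->
  (1 <= i <= 2 * N - 1)%nat -> w (mesh a b r N i) = 0 ->
  (forall m, (1 <= m <= N)%nat ->
     Rpower (INR N) (- r) ^ 3 * (Rpower (INR m) (r - 1) ^ 2 * Rpower (INR m) r) <= E) ->
  (forall m, (1 <= m <= N)%nat ->
     Rpower (INR N) (- r) ^ 3 * Rpower (INR m) (r - 1) ^ 3 <= Phi m - Phi (m - 1)%nat) ->
  Phi N - Phi O <= E ->
  Rabs (RInt (quotient alpha w (mesh a b r N i)) a b)
    <= truncation_const a b alpha r M * E
       * Rpower (boundary_dist a b (mesh a b r N i)) (- alpha).
Proof.
intros Hab Ha Hr HN HK0 Hw HM HW Hi Hwx HE HF HFE.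
set (L := (b - a) / 2). set (K := L * Rmax 1 r). set (nu := Rpower (INR N) (- r)) in *.
assert (HL : 0 < L) by (unfold L; lra).
assert (HK : 0 <= K) by (unfold K; pose proof (Rmax_l 1 r); nra).
assert (Hnu : 0 < nu) by apply Rpower_gt0.
pose proof (mesh_interior a b r N i Hab Hr HN Hi) as Hx.
set (x := mesh a b r N i) in *. set (d := boundary_dist a b x).
assert (Hd : 0 < d) by (apply Rmin_glb_lt; lra).
assert (Hda : d <= x - a) by apply Rmin_l.
assert (Hdb : d <= b - x) by apply Rmin_r.
assert (Hf : forall y, continuous (quotient alpha w x) y)
  by (intros y; apply continuous_quotient with K0; assumption).
set (c1 := M * K ^ 3 * Rpower (d / 2) (- alpha)).
set (c2 := M / (1 - alpha) * (2 * L * K ^ 2 * E / d)).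
set (cp := fun y => clipped_power (d / 2) (1 - alpha) (y - x)).
assert (Hgr : forall m, (1 <= m)%nat ->
          graded a b r N m = L * (Rpower (INR m) r * nu)).
{ intros m Hm. assert (1 <= INR m) by (apply (le_INR 1); exact Hm).
  unfold graded. rewrite rpow_pos by lra. reflexivity. }
assert (Hside : forall k, (1 <= k <= 2 * N)%nat ->
          x <= mesh a b r N (k - 1) \/ mesh a b r N k <= x).
{ intros k Hk. destruct (Nat.le_gt_cases i (k - 1)).
  - left. apply mesh_le; try assumption; lia.
  - right. apply mesh_le; try assumption; lia. }
assert (Hleft : Rabs (RInt (quotient alpha w x) a (a + L))
          <= c1 * (Phi N - Phi O) + c2 * (cp (a + L) - cp a)).
{ pose proof (RInt_telescope (quotient alpha w x) (mesh a b r N)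
    (fun m => c1 * Phi m + c2 * cp (mesh a b r N m)) N Hf) as H.
  cbv beta in H.
  rewrite mesh_first, mesh_left, graded_N in H by lia. fold L in H.
  eapply Rle_trans; [apply H|right; ring].
  intros n Hn. pose proof (Hside (S n) ltac:(lia)) as Hs.
  pose proof (HW (S n) ltac:(lia)) as HWn. pose proof (HF (S n) ltac:(lia)) as HFn.
  replace (S n - 1)%nat with n in Hs, HWn, HFn by lia.
  eapply Rle_trans.
  - apply (cell_estimate alpha K0 K L M nu (Rpower (INR (S n)) (r - 1))
             (Rpower (INR (S n)) r) E (Phi (S n) - Phi n) d x); try assumption;
      try apply Rpower_gt0; try (apply HE; lia).
    + apply mesh_lt; try assumption; lia.
    + rewrite !mesh_left by lia.
      pose proof (graded_step a b r N (S n) Hab Hr ltac:(lia)) as Hst.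
      replace (S n - 1)%nat with n in Hst by lia.
      unfold K, L, nu. lra.
    (* A cell reaching beyond [x - d / 2] has its right node farther than [d / 2] from [a], because
       [d <= x - a]. *)
    + destruct (Rle_dec (mesh a b r N (S n)) (x - d / 2)) as [Hc|Hc].
      * left. right. exact Hc.
      * right. rewrite mesh_left, Hgr in Hc by lia. lra.
  - unfold c1, c2, cp. right. ring. }
(* The nodes now decrease from [b] to the midpoint, so the clipped power enters the antiderivative
   with a minus sign while [Phi] is reused unchanged. *)
assert (Hright : Rabs (RInt (quotient alpha w x) b (a + L))
          <= c1 * (Phi N - Phi O) + c2 * (cp b - cp (a + L))).
{ pose proof (RInt_telescope (quotient alpha w x) (fun m => mesh a b r N (2 * N - m))
    (fun m => c1 * Phi m - c2 * cp (mesh a b r N (2 * N - m))) N Hf) as H.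
  cbv beta in H.
  replace (2 * N - 0)%nat with (2 * N)%nat in H by lia.
  replace (2 * N - N)%nat with N in H by lia.
  rewrite mesh_last, mesh_left, graded_N in H by lia. fold L in H.
  eapply Rle_trans; [apply H|right; ring].
  intros n Hn. pose proof (Hside (2 * N - n)%nat ltac:(lia)) as Hs.
  pose proof (HW (2 * N - n)%nat ltac:(lia)) as HWn. pose proof (HF (S n) ltac:(lia)) as HFn.
  replace (2 * N - n - 1)%nat with (2 * N - S n)%nat in Hs, HWn by lia.
  replace (S n - 1)%nat with n in HFn by lia.
  rewrite <- (opp_RInt_swap (V := R_CompleteNormedModule))
    by (apply ex_RInt_continuous_everywhere, Hf).
  unfold opp; simpl opp. rewrite Rabs_Ropp.
  eapply Rle_trans.
  - apply (cell_estimate alpha K0 K L M nu (Rpower (INR (S n)) (r - 1))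
             (Rpower (INR (S n)) r) E (Phi (S n) - Phi n) d x); try assumption;
      try apply Rpower_gt0; try (apply HE; lia).
    + rewrite !mesh_right by lia. pose proof (graded_lt a b r N n Hab Hr). lra.
    + rewrite !mesh_right by lia.
      pose proof (graded_step a b r N (S n) Hab Hr ltac:(lia)) as Hst.
      replace (S n - 1)%nat with n in Hst by lia.
      unfold K, L, nu. lra.
    + destruct (Rle_dec (x + d / 2) (mesh a b r N (2 * N - S n))) as [Hc|Hc].
      * left. left. exact Hc.
      * right. rewrite mesh_right, Hgr in Hc by lia. lra.
  - unfold c1, c2, cp. right. ring. }
assert (HE0 : 0 <= E).
{ eapply Rle_trans; [|apply (HE 1%nat); lia].
  apply Rmult_le_pos; [apply pow_le; lra|].
  apply Rmult_le_pos; [apply pow_le|]; left; apply Rpower_gt0. }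
rewrite <- (RInt_Chasles (V := R_CompleteNormedModule) _ a (a + L) b)
  by (apply ex_RInt_continuous_everywhere, Hf).
rewrite <- (opp_RInt_swap (V := R_CompleteNormedModule) _ b (a + L))
  by (apply ex_RInt_continuous_everywhere, Hf).
unfold plus, opp; simpl. eapply Rle_trans; [apply Rabs_triang|]. rewrite Rabs_Ropp.
pose proof (Rpower_gt0 (d / 2) (- alpha)) as Hrho.
set (rho := Rpower (d / 2) (- alpha)) in *.
assert (HK3 : 0 <= K ^ 3) by (apply pow_le, HK).
assert (HK2 : 0 <= K ^ 2) by (apply pow_le, HK).
assert (HLK : 0 <= 2 * L * K ^ 2) by (apply Rmult_le_pos; lra).
assert (Hc1 : 0 <= c1) by (unfold c1; apply Rmult_le_pos; [apply Rmult_le_pos; lra|lra]).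
assert (Hc2 : 0 <= c2).
{ unfold c2. apply Rmult_le_pos; [apply Rdiv_le_0_compat; lra|].
  apply Rdiv_le_0_compat; [|exact Hd]. apply Rmult_le_pos; assumption. }
assert (Hcp : cp b - cp a <= d * rho).
{ unfold cp.
  pose proof (clipped_power_bound (d / 2) (1 - alpha) (b - x) ltac:(lra) ltac:(lra)).
  pose proof (clipped_power_bound (d / 2) (1 - alpha) (a - x) ltac:(lra) ltac:(lra)).
  assert (Rpower (d / 2) (1 - alpha) = d / 2 * rho).
  { unfold rho, Rminus. rewrite Rpower_plus, Rpower_1 by lra. reflexivity. }
  lra. }
assert (Hrho2 : rho <= 2 * Rpower d (- alpha)).
{ unfold rho, Rdiv. rewrite <- Rpower_mult_distr by lra.
  pose proof (Rpower_gt0 d (- alpha)).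
  assert (Rpower (/ 2) (- alpha) <= 2).
  { replace 2 with (Rpower (/ 2) (Ropp 1)) at 2.
    - apply Rpower_le_exponent; lra.
    - rewrite Rpower_Ropp, Rpower_1 by lra. apply Rinv_inv. }
  nra. }
apply Rle_trans with (2 * c1 * E + c2 * (d * rho)).
{ assert (c1 * (Phi N - Phi O) <= c1 * E) by (apply Rmult_le_compat_l; assumption).
  assert (c2 * (cp b - cp a) <= c2 * (d * rho)) by (apply Rmult_le_compat_l; assumption).
  lra. }
unfold c1, c2. fold rho.
replace (2 * (M * K ^ 3 * rho) * E
         + M / (1 - alpha) * (2 * L * K ^ 2 * E / d) * (d * rho))
  with ((2 * M * K ^ 3 + M * (2 * L * K ^ 2 / (1 - alpha))) * E * rho) by (field; lra).
assert (Hq : 0 <= 2 * L * K ^ 2 / (1 - alpha)).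
{ apply Rdiv_le_0_compat; lra. }
apply Rle_trans with ((2 * M * K ^ 3 + 2 * (M * (2 * L * K ^ 2 / (1 - alpha)))) * E
                       * (2 * Rpower d (- alpha))).
- set (Q := 2 * L * K ^ 2 / (1 - alpha)) in *.
  assert (0 <= M * K ^ 3) by (apply Rmult_le_pos; assumption).
  assert (0 <= M * Q) by (apply Rmult_le_pos; assumption).
  apply Rmult_le_compat; [apply Rmult_le_pos; lra|lra| |exact Hrho2].
  apply Rmult_le_compat_r; lra.
- unfold truncation_const. fold L. fold K. right. ring.
Qed.

(** * Hat functions and error rates *)

Lemma kernel_int_ext (a b alpha x : R) (g1 g2 : R -> R) :
  (forall y, g1 y = g2 y) -> kernel_int a b alpha g1 x = kernel_int a b alpha g2 x.
Proof.
intros H. unfold kernel_int. apply (RInt_ext (V := R_CompleteNormedModule)).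
intros y _. rewrite !H. reflexivity.
Qed.

Lemma kernel_int_scal (a b alpha K c x : R) (g : R -> R) :
  0 < alpha < 1 -> a <= x <= b -> 0 <= K -> lipschitz_on a b K g ->
  kernel_int a b alpha (fun y => g y * c) x = kernel_int a b alpha g x * c.
Proof.
intros Ha Hx HK H.
pose proof (RInt_scal (V := R_CompleteNormedModule) _ a b c
  (ex_kernel_int a b alpha K x g Ha Hx HK H)) as E.
rewrite Rmult_comm. etransitivity; [|exact E].
unfold kernel_int. apply (RInt_ext (V := R_CompleteNormedModule)). intros y _.
unfold scal, quotient, Rdiv; simpl. unfold mult; simpl. ring.
Qed.

Lemma lipschitz_on_scal (a b K c : R) (g : R -> R) :
  lipschitz_on a b K g -> lipschitz_on a b (K * Rabs c) (fun y => g y * c).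
Proof.
intros H y z Hy Hz. specialize (H y z Hy Hz).
replace (g y * c - g z * c) with ((g y - g z) * c) by ring.
rewrite Rabs_mult. pose proof (Rabs_pos c). nra.
Qed.

(** Coefficients are numbered from 0 as in the matrices, so [c l] belongs to the hat at node
    [l + 1]. As [sum_n] includes its upper index, [n = 2 N - 2] gives all [2 N - 1] interior
    hats. *)
Definition hat_combination (phi : nat -> R -> R) (c : nat -> R) (n : nat) (y : R) : R :=
  sum_n (fun l => phi (S l) y * c l) n.

(** Written as a difference so that [kernel_int_sub] applies directly in the induction. *)
Lemma hat_combination_S (phi : nat -> R -> R) (c : nat -> R) (n : nat) (y : R) :
  hat_combination phi c (S n) y
    = hat_combination phi c n y - phi (S (S n)) y * - c (S n).
Proof.
unfold hat_combination. rewrite sum_Sn. unfold plus; simpl. ring.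
Qed.

Lemma hat_combination_0 (phi : nat -> R -> R) (c : nat -> R) (y : R) :
  hat_combination phi c 0 y = phi 1%nat y * c O.
Proof. unfold hat_combination. apply sum_O. Qed.

Lemma hat_combination_affine (a b r : R) (N : nat) (phi : nat -> R -> R)
    (c : nat -> R) (n : nat) :
  (forall j, (1 <= j <= S n)%nat -> piecewise_affine a b r N (phi j)) ->
  piecewise_affine a b r N (hat_combination phi c n).
Proof.
induction n as [|n IH]; intros H k Hk.
- destruct (H 1%nat ltac:(lia) k Hk) as [c1 [d1 H1]].
  exists (c1 * c O), (d1 * c O). intros y Hy.
  rewrite hat_combination_0, H1 by exact Hy. ring.
- destruct (IH ltac:(intros; apply H; lia) k Hk) as [c0 [d0 H0]].
  destruct (H (S (S n)) ltac:(lia) k Hk) as [c1 [d1 H1]].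
  exists (c0 + c1 * c (S n)), (d0 + d1 * c (S n)). intros y Hy.
  rewrite hat_combination_S, H0, H1 by exact Hy. ring.
Qed.

Lemma hat_combination_node (phi : nat -> R -> R) (c : nat -> R) (n k : nat) (y : R) :
  (forall j, (1 <= j <= S n)%nat -> phi j y = if Nat.eqb j k then 1 else 0) ->
  hat_combination phi c n y
    = if andb (Nat.leb 1 k) (Nat.leb k (S n)) then c (k - 1)%nat else 0.
Proof.
induction n as [|n IH]; intros H.
- rewrite hat_combination_0, H by lia.
  destruct k as [|[|k]]; simpl; ring.
- rewrite hat_combination_S, H, IH by (try (intros; apply H); lia).
  destruct (Nat.eqb_spec (S (S n)) k) as [<-|Hne].
  + rewrite (proj2 (Nat.leb_gt (S (S n)) (S n))), (Nat.leb_refl (S (S n))) by lia.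
    replace (S (S n) - 1)%nat with (S n) by lia. simpl. ring.
  + replace (Nat.leb k (S (S n))) with (Nat.leb k (S n)); [ring|].
    destruct (Nat.leb_spec k (S n)), (Nat.leb_spec k (S (S n))); (reflexivity || lia).
Qed.

Lemma kernel_int_hat_combination (a b alpha r x : R) (N : nat) (phi : nat -> R -> R)
    (c : nat -> R) (n : nat) :
  a < b -> 0 < alpha < 1 -> 0 < r -> (1 <= N)%nat -> a <= x <= b ->
  (forall j, (1 <= j <= S n)%nat -> piecewise_affine a b r N (phi j)) ->
  kernel_int a b alpha (hat_combination phi c n) x
    = sum_n (fun l => kernel_int a b alpha (phi (S l)) x * c l) n.
Proof.
intros Hab Ha Hr HN Hx. induction n as [|n IH]; intros H.
- rewrite sum_O, (kernel_int_ext _ _ _ _ _ (fun y => phi 1%nat y * c O))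
    by (apply hat_combination_0).
  destruct (piecewise_affine_lipschitz a b r N (phi 1%nat) Hab Hr HN
              (H 1%nat ltac:(lia))) as [K [HK HL]].
  apply kernel_int_scal with K; assumption.
- rewrite sum_Sn, <- IH by (intros; apply H; lia).
  rewrite (kernel_int_ext _ _ _ _ _ _ (hat_combination_S phi c n)).
  destruct (piecewise_affine_lipschitz a b r N (phi (S (S n))) Hab Hr HN
              (H (S (S n)) ltac:(lia))) as [K [HK HL]].
  destruct (piecewise_affine_lipschitz a b r N (hat_combination phi c n) Hab Hr HN)
    as [K' [HK' HL']]; [apply hat_combination_affine; intros; apply H; lia|].
  assert (HKc : 0 <= K * Rabs (- c (S n)))
    by (apply Rmult_le_pos; [exact HK|apply Rabs_pos]).
  rewrite (kernel_int_sub a b alpha K' (K * Rabs (- c (S n))))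
    by (try apply lipschitz_on_scal; assumption).
  rewrite (kernel_int_scal a b alpha K) by assumption.
  unfold plus; simpl. ring.
Qed.

Lemma hat_piecewise_affine (a b r : R) (N j : nat) (phi : R -> R) :
  is_hat a b r N j phi -> piecewise_affine a b r N phi.
Proof. intros [_ [H _]]. exact H. Qed.

Lemma solves_nonlocal_kernel_int (a b alpha K x : R) (f u : R -> R) :
  0 < alpha < 1 -> 0 <= K -> lipschitz_on a b K u ->
  solves_nonlocal a b alpha f u -> a < x < b ->
  kernel_int a b alpha u x = f x.
Proof.
intros Ha HK HL [H _] Hx. rewrite <- (H x Hx).
pose proof (RInt_opp (V := R_CompleteNormedModule) _ a b
  (ex_kernel_int a b alpha K x u Ha ltac:(lra) HK HL)) as E.
rewrite (RInt_ext (V := R_CompleteNormedModule)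
  _ (fun y => opp (quotient alpha u x y))).
- etransitivity; [|exact (f_equal Ropp (eq_sym E))].
  unfold opp; simpl. rewrite Ropp_involutive. reflexivity.
- intros y _. unfold opp, quotient, Rdiv; simpl. ring.
Qed.

Lemma collocation_equation (a b alpha r : R) (N i : nat) (f : R -> R)
    (phi : nat -> R -> R) (U : @matrix R (2 * N - 1) 1) :
  a < b -> 0 < alpha < 1 -> 0 < r -> (1 <= N)%nat ->
  (forall j, (j <= 2 * N)%nat -> piecewise_affine a b r N (phi j)) ->
  @Mmult R_Ring (2 * N - 1) (2 * N - 1) 1
    (colloc_matrix a b alpha r N phi) U = colloc_rhs a b r N f ->
  (1 <= i <= 2 * N - 1)%nat ->
  kernel_int a b alpha (hat_combination phi (fun l => coeff_mat 0 U l 0) (2 * N - 2))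
    (mesh a b r N i) = f (mesh a b r N i).
Proof.
intros Hab Ha Hr HN Hphi HU Hi.
rewrite (kernel_int_hat_combination a b alpha r _ N);
  [|assumption..|apply mesh_in; try assumption; lia|intros; apply Hphi; lia].
apply (f_equal (fun A => coeff_mat 0 A (i - 1) 0)) in HU.
unfold Mmult, colloc_rhs in HU. rewrite !coeff_mat_bij in HU by lia.
replace (S (i - 1)) with i in HU by lia. rewrite <- HU.
replace (Nat.pred (2 * N - 1)) with (2 * N - 2)%nat by lia.
apply sum_n_ext_loc. intros l Hl. unfold colloc_matrix.
rewrite coeff_mat_bij by lia. replace (S (i - 1)) with i by lia. reflexivity.
Qed.

(** Up to constants, the first quantity is [h_m^2] times the distance of cell [m] to the boundary
    and the second is [h_m^3]. The existence of [Phi] bounds the sum of the latter by [E] and lets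
    an explicit antiderivative be supplied. *)
Definition graded_sums_bounded (r : R) (N : nat) (E : R) : Prop :=
  (forall m, (1 <= m <= N)%nat ->
     Rpower (INR N) (-3 * r) * Rpower (INR m) (3 * r - 2) <= E) /\
  exists Phi : nat -> R,
    (forall m, (1 <= m <= N)%nat ->
       Rpower (INR N) (-3 * r) * Rpower (INR m) (3 * r - 3) <= Phi m - Phi (m - 1)%nat) /\
    Phi N - Phi O <= E.

Lemma Rpower_cube (x s : R) : Rpower x s ^ 3 = Rpower x (3 * s).
Proof.
replace (3 * s) with (s + (s + s)) by ring. rewrite !Rpower_plus. ring.
Qed.

Lemma nodal_error (a b alpha r K M E : R) (f u : R -> R) (N : nat)
    (phi : nat -> R -> R) (U : @matrix R (2 * N - 1) 1) :
  a < b -> 0 < alpha < 1 -> 0 < r -> (1 <= N)%nat ->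
  solves_nonlocal a b alpha f u ->
  0 <= K -> 0 <= M -> lipschitz_on a b K u ->
  (forall p q y, a <= p -> p < q -> q <= b -> p <= y <= q ->
     Rabs (u y - (u p + (u q - u p) / (q - p) * (y - p))) <= M * (q - p) ^ 2) ->
  (forall j : nat, (j <= 2 * N)%nat -> is_hat a b r N j (phi j)) ->
  @Mmult R_Ring (2 * N - 1) (2 * N - 1) 1
    (colloc_matrix a b alpha r N phi) U = colloc_rhs a b r N f ->
  graded_sums_bounded r N E ->
  forall i, (1 <= i <= 2 * N - 1)%nat ->
  Rabs (u (mesh a b r N i) - coeff_mat 0 U (i - 1) 0)
    <= 4 * (truncation_const a b alpha r M * E) / graded a b r N 1.
Proof.
intros Hab Ha Hr HN Hu HK HM HL Hint Hphi HU [HE [Phi [HF HFE]]].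
assert (Haff : forall j, (j <= 2 * N)%nat -> piecewise_affine a b r N (phi j))
  by (intros j Hj; eapply hat_piecewise_affine, Hphi, Hj).
set (pu := hat_combination phi (fun l => u (mesh a b r N (S l))) (2 * N - 2)).
set (uh := hat_combination phi (fun l => coeff_mat 0 U l 0) (2 * N - 2)).
assert (Hpu : piecewise_affine a b r N pu)
  by (apply hat_combination_affine; intros; apply Haff; lia).
assert (Huh : piecewise_affine a b r N uh)
  by (apply hat_combination_affine; intros; apply Haff; lia).
assert (Hnode : forall c k, (k <= 2 * N)%nat ->
  hat_combination phi c (2 * N - 2) (mesh a b r N k)
    = if andb (Nat.leb 1 k) (Nat.leb k (S (2 * N - 2))) then c (k - 1)%nat else 0)
  by (intros c k Hk; apply hat_combination_node; intros j Hj; apply Hphi; lia).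
assert (Hin : forall c k, (1 <= k <= 2 * N - 1)%nat ->
  hat_combination phi c (2 * N - 2) (mesh a b r N k) = c (k - 1)%nat).
{ intros c k Hk. rewrite Hnode by lia.
  rewrite (proj2 (Nat.leb_le 1 k)), (proj2 (Nat.leb_le k _)) by lia. reflexivity. }
assert (H0 : forall c, hat_combination phi c (2 * N - 2) a = 0).
{ intros c. rewrite <- (mesh_first a b r N HN). rewrite Hnode by lia. reflexivity. }
assert (H1 : forall c, hat_combination phi c (2 * N - 2) b = 0).
{ intros c. rewrite <- (mesh_last a b r N HN). rewrite Hnode by lia.
  rewrite (proj2 (Nat.leb_gt (2 * N) _)), Bool.andb_false_r by lia. reflexivity. }
assert (Hua : u a = 0) by (apply Hu; lra).
assert (Hub : u b = 0) by (apply Hu; lra).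
(* Interior hats suffice to interpolate at the two end nodes as well, because [u] vanishes there. *)
assert (Hpu_node : forall k, (k <= 2 * N)%nat -> pu (mesh a b r N k) = u (mesh a b r N k)).
{ intros k Hk. destruct (Nat.eq_dec k 0) as [->|Hk0].
  { rewrite mesh_first, Hua by exact HN. apply H0. }
  destruct (Nat.eq_dec k (2 * N)) as [->|Hk1].
  { rewrite mesh_last, Hub by exact HN. apply H1. }
  unfold pu. rewrite Hin by lia. replace (S (k - 1)) with k by lia. reflexivity. }
destruct (piecewise_affine_lipschitz a b r N pu Hab Hr HN Hpu) as [Kp [HKp HLp]].
destruct (piecewise_affine_lipschitz a b r N uh Hab Hr HN Huh) as [Kh [HKh HLh]].
set (w := fun y => pu y - u y).
assert (HLw : lipschitz_on a b (Kp + K) w) by (apply lipschitz_on_sub; assumption).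
assert (HT : forall i, (1 <= i <= 2 * N - 1)%nat ->
  Rabs (kernel_int a b alpha w (mesh a b r N i))
    <= truncation_const a b alpha r M * E
       * Rpower (boundary_dist a b (mesh a b r N i)) (- alpha)).
{ intros i Hi. pose proof (mesh_interior a b r N i Hab Hr HN Hi) as Hx.
  rewrite kernel_int_clip by lra.
  apply (truncation_bound a b alpha r (Kp + K) M E Phi N i); try assumption; [lra| | | | |].
  - apply lipschitz_clip; [lra|lra|exact HLw].
  - intros k Hk y Hy.
    pose proof (mesh_in a b r N (k - 1) Hab Hr HN ltac:(lia)) as Hp.
    pose proof (mesh_in a b r N k Hab Hr HN ltac:(lia)) as Hq.
    pose proof (mesh_lt a b r N (k - 1) Hab Hr HN ltac:(lia)) as Hlt.
    replace (S (k - 1)) with k in Hlt by lia.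
    rewrite clip_id by lra. unfold w.
    rewrite (piecewise_affine_interp a b r N k pu y), !Hpu_node by (assumption || lia).
    rewrite Rabs_minus_sym. apply Hint; lra.
  - rewrite clip_id by lra. unfold w. rewrite Hpu_node by lia. ring.
  - intros m Hm. rewrite Rpower_cube. replace (3 * - r) with (-3 * r) by ring.
    replace (Rpower (INR m) (r - 1) ^ 2 * Rpower (INR m) r)
      with (Rpower (INR m) (3 * r - 2)); [apply HE, Hm|].
    replace (3 * r - 2) with ((r - 1) + ((r - 1) + r)) by ring.
    rewrite !Rpower_plus. ring.
  - intros m Hm. rewrite !Rpower_cube. replace (3 * - r) with (-3 * r) by ring.
    replace (3 * (r - 1)) with (3 * r - 3) by ring. apply HF, Hm. }
(* Both [u] and [uh] give [f] at the collocation points, so [u] may replace [uh] under the operator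
   there. *)
assert (Hker : forall i, (1 <= i <= 2 * N - 1)%nat ->
  kernel_int a b alpha pu (mesh a b r N i) - kernel_int a b alpha uh (mesh a b r N i)
    = kernel_int a b alpha w (mesh a b r N i)).
{ intros i Hi. pose proof (mesh_interior a b r N i Hab Hr HN Hi) as Hx.
  unfold uh. rewrite (collocation_equation a b alpha r N i f phi U) by assumption.
  rewrite <- (solves_nonlocal_kernel_int a b alpha K _ f u) by assumption.
  unfold w. rewrite (kernel_int_sub a b alpha Kp K) by (assumption || lra).
  reflexivity. }
assert (HB : 0 <= truncation_const a b alpha r M * E).
{ apply Rmult_le_pos.
  - unfold truncation_const. set (L := (b - a) / 2).
    assert (HLp0 : 0 <= L) by (unfold L; lra).
    assert (HRm : 0 <= L * Rmax 1 r) by (pose proof (Rmax_l 1 r); nra).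
    pose proof (pow_le _ 3 HRm). pose proof (pow_le _ 2 HRm).
    apply Rmult_le_pos; [lra|]. apply Rplus_le_le_0_compat; [assumption|].
    apply Rdiv_le_0_compat; [apply Rmult_le_pos; lra|lra].
  - eapply Rle_trans; [|apply (HE 1%nat); lia].
    apply Rmult_le_pos; left; apply Rpower_gt0. }
intros i Hi. rewrite <- (Hpu_node i) by lia.
replace (coeff_mat 0 U (i - 1) 0) with (uh (mesh a b r N i)) by (unfold uh; apply Hin, Hi).
(* The maximum principle is one-sided; it is applied to the nodal error and to its negative. *)
apply Rabs_le. split.
- enough (uh (mesh a b r N i) - pu (mesh a b r N i)
            <= 4 * (truncation_const a b alpha r M * E) / graded a b r N 1) by lra.
  apply (discrete_maximum_principle a b alpha r _ N (fun y => uh y - pu y));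
    try assumption; try lia.
  + apply piecewise_affine_sub; assumption.
  + unfold uh, pu. rewrite !H0. ring.
  + unfold uh, pu. rewrite !H1. ring.
  + intros j Hj. rewrite (kernel_int_sub a b alpha Kh Kp) by
      (try assumption; apply mesh_in; try assumption; lia).
    specialize (HT j Hj). rewrite <- Hker in HT by exact Hj.
    apply Rabs_le_between in HT. lra.
- apply (discrete_maximum_principle a b alpha r _ N (fun y => pu y - uh y));
    try assumption; try lia.
  + apply piecewise_affine_sub; assumption.
  + unfold uh, pu. rewrite !H0. ring.
  + unfold uh, pu. rewrite !H1. ring.
  + intros j Hj. rewrite (kernel_int_sub a b alpha Kp Kh) by
      (try assumption; apply mesh_in; try assumption; lia).
    rewrite Hker by exact Hj. eapply Rle_trans; [apply Rle_abs|apply HT, Hj].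
Qed.

(** The factor [N^r] is the reciprocal of the first cell width. The constant comes from the
    interpolation data of [u] alone, fixed before [N]; [Rabs C0 + 1] makes it positive even when
    [C0] is zero. *)
Lemma error_rate (a b alpha r : R) (f u : R -> R) (G : nat -> R) :
  a < b -> 0 < alpha < 1 -> 0 < r ->
  solves_nonlocal a b alpha f u -> C2_on a b u ->
  (forall N, (2 <= N)%nat -> graded_sums_bounded r N (G N)) ->
  exists C, 0 < C /\
    forall N, (2 <= N)%nat ->
    forall phi : nat -> R -> R,
      (forall j : nat, (j <= 2 * N)%nat -> is_hat a b r N j (phi j)) ->
    forall U : @matrix R (2 * N - 1) 1,
      @Mmult R_Ring (2 * N - 1) (2 * N - 1) 1
        (colloc_matrix a b alpha r N phi) U = colloc_rhs a b r N f ->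
      max_error a b r N u U <= C * (Rpower (INR N) r * G N).
Proof.
intros Hab Ha Hr Hu HC2 HG.
destruct (C2_interpolation_error a b u Hab HC2) as [K [M [HK [HM [HL Hint]]]]].
set (C0 := 4 * truncation_const a b alpha r M / ((b - a) / 2)).
pose proof (Rabs_pos C0) as HC0.
exists (Rabs C0 + 1). split; [lra|].
intros N HN phi Hphi U HU. unfold max_error.
match goal with |- MaxRlist ?l <= _ => assert (Hmem : In (MaxRlist l) l) end.
{ apply MaxRlist_P2. eexists. apply in_map, in_seq. split; [apply Nat.le_refl|lia]. }
apply in_map_iff in Hmem. destruct Hmem as [i [<- Hi]]. apply in_seq in Hi.
eapply Rle_trans.
- apply (nodal_error a b alpha r K M (G N) f u N phi U); try assumption; try lia.
  apply HG, HN.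
- assert (HN1 : 1 <= INR N) by (apply (le_INR 1); lia).
  assert (HGN : 0 <= G N).
  { eapply Rle_trans; [|apply (proj1 (HG N HN) 1%nat); lia].
    apply Rmult_le_pos; left; apply Rpower_gt0. }
  pose proof (Rpower_gt0 (INR N) r) as HP.
  rewrite graded_1, Rpower_Ropp.
  replace (4 * (truncation_const a b alpha r M * G N) / ((b - a) / 2 * / Rpower (INR N) r))
    with (C0 * (Rpower (INR N) r * G N)) by (unfold C0; field; lra).
  apply Rmult_le_compat_r; [apply Rmult_le_pos; lra|].
  pose proof (Rle_abs C0). lra.
Qed.

(** * The power sums in the three ranges of the grading exponent *)

(** The exponent [3r - 2] is positive, so the products peak at [m = N] and the sum grows like
    [N^(3r-2)]; both are of order [N^(-2)] after scaling. *)
Lemma graded_sums_gt (r : R) (N : nat) : 2 / 3 < r -> (1 <= N)%nat ->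
  graded_sums_bounded r N (/ Rmin 1 (3 * r - 2) * Rpower (INR N) (-2)).
Proof.
intros Hr HN. set (q := Rmin 1 (3 * r - 2)).
assert (Hq : 0 < q <= 1)
  by (unfold q; split; [apply Rmin_glb_lt; lra|apply Rmin_l]).
assert (Hq1 : 1 <= / q) by (rewrite <- Rinv_1; apply Rinv_le_contravar; lra).
assert (HN1 : 1 <= INR N) by (apply (le_INR 1); exact HN).
assert (E2 : Rpower (INR N) (-3 * r) * Rpower (INR N) (3 * r - 2) = Rpower (INR N) (-2))
  by (rewrite <- Rpower_plus; f_equal; ring).
pose proof (Rpower_gt0 (INR N) (-3 * r)) as HG.
split.
- intros m Hm.
  assert (Hm1 : 1 <= INR m) by (apply (le_INR 1); lia).
  apply Rle_trans with (Rpower (INR N) (-2)).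
  + rewrite <- E2. apply Rmult_le_compat_l; [lra|]. apply Rpower_le; [|lra].
    split; [lra|apply le_INR; lia].
  + pose proof (Rpower_gt0 (INR N) (-2)). nra.
- exists (fun m => Rpower (INR N) (-3 * r) * (/ q * rpow (INR m) (3 * r - 2))). split.
  + intros m Hm.
    pose proof (power_increment_gt (3 * r - 2) m ltac:(lra) ltac:(lia)) as H.
    fold q in H. replace (3 * r - 2 - 1) with (3 * r - 3) in H by ring.
    apply Rmult_le_compat_l with (r := Rpower (INR N) (-3 * r)) in H; [lra|lra].
  + simpl (INR 0). rewrite (rpow_npos 0), (rpow_pos (INR N)) by lra.
    rewrite <- E2. right. ring.
Qed.

(** The products all equal [N^(-2)] and the sum is harmonic, at most [1 + ln N]. The 1 is absorbed
    through [ln N >= ln 2], which is where [N >= 2] matters. *)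
Lemma graded_sums_eq (N : nat) : (2 <= N)%nat ->
  graded_sums_bounded (2 / 3) N ((1 + / ln 2) * (Rpower (INR N) (-2) * ln (INR N))).
Proof.
intros HN. assert (HN1 : 2 <= INR N) by (apply (le_INR 2); exact HN).
assert (Hl2 : 0 < ln 2) by (rewrite <- ln_1; apply ln_increasing; lra).
assert (HlN : ln 2 <= ln (INR N)) by (apply ln_le; lra).
pose proof (Rpower_gt0 (INR N) (-2)) as HG.
assert (H1 : 1 + ln (INR N) <= (1 + / ln 2) * ln (INR N)).
{ assert (1 <= / ln 2 * ln (INR N)).
  { apply Rmult_le_reg_l with (ln 2); [lra|].
    rewrite <- Rmult_assoc, Rinv_r by lra. lra. }
  lra. }
unfold graded_sums_bounded.
replace (-3 * (2 / 3)) with (-2) by field.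
replace (3 * (2 / 3) - 2) with 0 by field.
replace (3 * (2 / 3) - 3) with (Ropp 1) by field.
split.
- intros m Hm. assert (Hm1 : 1 <= INR m) by (apply (le_INR 1); lia).
  rewrite Rpower_O by lra. nra.
(* The jump from [0] to [1] at the start pays for the term [m = 1]; the logarithmic increments begin
   at [m = 2]. *)
- exists (fun m => Rpower (INR N) (-2) * match m with O => 0 | _ => 1 + ln (INR m) end).
  split.
  + intros m Hm. assert (Hm1 : 1 <= INR m) by (apply (le_INR 1); lia).
    rewrite Rpower_Ropp, Rpower_1 by lra. rewrite <- Rmult_minus_distr_l.
    apply Rmult_le_compat_l; [lra|].
    destruct m as [|[|m]]; [lia|simpl; rewrite ln_1, Rinv_1; lra|].
    pose proof (power_increment_log (S (S m)) ltac:(lia)) as H.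
    replace (S (S m) - 1)%nat with (S m) in * by lia. lra.
  + destruct N as [|N]; [lia|]. nra.
Qed.

(** Now [3r - 2 = -s] is negative: the products peak at [m = 1] and the series of [m^(-s-1)]
    converges, with sum at most [1 + 1/s]. Only the prefactor [N^(-3r)] survives. *)
Lemma graded_sums_lt (r : R) (N : nat) : 0 < r < 2 / 3 -> (1 <= N)%nat ->
  graded_sums_bounded r N ((1 + / (2 - 3 * r)) * Rpower (INR N) (-3 * r)).
Proof.
intros Hr HN. set (s := 2 - 3 * r).
assert (Hs : 0 < s) by (unfold s; lra).
assert (Hs1 : 0 < / s) by (apply Rinv_0_lt_compat, Hs).
pose proof (Rpower_gt0 (INR N) (-3 * r)) as HG.
unfold graded_sums_bounded.
replace (3 * r - 2) with (- s) by (unfold s; ring).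
replace (3 * r - 3) with (- s - 1) by (unfold s; ring).
split.
- intros m Hm. assert (Hm1 : 1 <= INR m) by (apply (le_INR 1); lia).
  assert (Rpower (INR m) (- s) <= 1).
  { rewrite Rpower_Ropp, <- Rinv_1. apply Rinv_le_contravar; [lra|].
    rewrite <- (Rpower_O (INR m)) by lra. apply Rle_Rpower; lra. }
  nra.
- exists (fun m => Rpower (INR N) (-3 * r)
            * match m with O => 0 | _ => 1 + / s * (1 - Rpower (INR m) (- s)) end).
  split.
  + intros m Hm. rewrite <- Rmult_minus_distr_l.
    apply Rmult_le_compat_l; [lra|].
    destruct m as [|[|m]]; [lia| |].
    * simpl. unfold Rpower. rewrite ln_1, !Rmult_0_r, exp_0. lra.
    * pose proof (power_increment_lt s (S (S m)) Hs ltac:(lia)) as H.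
      replace (S (S m) - 1)%nat with (S m) in * by lia. lra.
  + destruct N as [|N]; [lia|].
    pose proof (Rpower_gt0 (INR (S N)) (- s)) as HP.
    assert (/ s * (1 - Rpower (INR (S N)) (- s)) <= / s) by nra.
    nra.
Qed.

Theorem theorem3p5 :
  forall (a b alpha r : R) (f u : R -> R),
    a < b -> 0 < alpha < 1 -> 0 < r ->
    solves_nonlocal a b alpha f u ->
    C2_on a b u ->
    exists C : R, 0 < C /\
      forall N : nat, (2 <= N)%nat ->
      forall phi : nat -> R -> R,
        (forall j : nat, (j <= 2 * N)%nat -> is_hat a b r N j (phi j)) ->
      forall U : @matrix R (2 * N - 1) 1,
        @Mmult R_Ring (2 * N - 1) (2 * N - 1) 1
          (colloc_matrix a b alpha r N phi) U = colloc_rhs a b r N f ->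
        (2 / 3 < r -> max_error a b r N u U <= C * Rpower (INR N) (r - 2)) /\
        (r = 2 / 3 ->
           max_error a b r N u U <= C * Rpower (INR N) (r - 2) * ln (INR N)) /\
        (r < 2 / 3 -> max_error a b r N u U <= C * Rpower (INR N) (- 2 * r)).
Proof.
intros a b alpha r f u Hab Ha Hr Hu HC2.
(* The split precedes the choice of [C], since the constants built for the two open ranges blow up
   as [r] approaches [2/3]. *)
destruct (Rtotal_order r (2 / 3)) as [Hlt|[Heq|Hgt]].
- destruct (error_rate a b alpha r f u
    (fun N => (1 + / (2 - 3 * r)) * Rpower (INR N) (-3 * r))) as [C [HC H]];
    try assumption; [intros N HN; apply graded_sums_lt; [lra|lia]|].
  assert (Hc : 0 < 1 + / (2 - 3 * r))
    by (pose proof (Rinv_0_lt_compat (2 - 3 * r) ltac:(lra)); lra).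
  exists (C * (1 + / (2 - 3 * r))). split; [apply Rmult_lt_0_compat; assumption|].
  intros N HN phi Hphi U HU. repeat split; intros Hr'; try lra.
  eapply Rle_trans; [apply (H N HN phi Hphi U HU)|]. right.
  replace (-2 * r) with (r + -3 * r) by ring. rewrite Rpower_plus. ring.
- destruct (error_rate a b alpha r f u
    (fun N => (1 + / ln 2) * (Rpower (INR N) (-2) * ln (INR N)))) as [C [HC H]];
    try assumption; [intros N HN; rewrite Heq; apply graded_sums_eq, HN|].
  assert (Hc : 0 < 1 + / ln 2).
  { assert (0 < ln 2) by (rewrite <- ln_1; apply ln_increasing; lra).
    pose proof (Rinv_0_lt_compat (ln 2) ltac:(lra)); lra. }
  exists (C * (1 + / ln 2)). split; [apply Rmult_lt_0_compat; assumption|].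
  intros N HN phi Hphi U HU. repeat split; intros Hr'; try lra.
  eapply Rle_trans; [apply (H N HN phi Hphi U HU)|]. right.
  replace (r - 2) with (r + -2) by ring. rewrite Rpower_plus. ring.
- destruct (error_rate a b alpha r f u
    (fun N => / Rmin 1 (3 * r - 2) * Rpower (INR N) (-2))) as [C [HC H]];
    try assumption; [intros N HN; apply graded_sums_gt; [lra|lia]|].
  assert (Hc : 0 < / Rmin 1 (3 * r - 2))
    by (apply Rinv_0_lt_compat, Rmin_glb_lt; lra).
  exists (C * / Rmin 1 (3 * r - 2)). split; [apply Rmult_lt_0_compat; assumption|].
  intros N HN phi Hphi U HU. repeat split; intros Hr'; try lra.
  eapply Rle_trans; [apply (H N HN phi Hphi U HU)|]. right.
  replace (r - 2) with (r + -2) by ring. rewrite Rpower_plus. ring.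
Qed.
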